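(* Consider the noncommutative torus $A=\mathbb{C}_\theta[\mathbb{T}^2]$ with the Euclidean quantum metric $g=s^1\otimes s^1+s^2\otimes s^2$, a weak quantum Levi-Civita connection (WQLC) $\nabla$ on $\Omega^1$, and a rank-two free spinor bimodule $\mathcal S$ with central basis $\{e^1,e^2\}$ and the standard Hilbert space structure. Up to unitary equivalence, $$({\not\!D}\psi)_\beta=(\partial_i\psi_\alpha)\,\sigma^{i\,\alpha}{}_\beta \qquad (\text{sum over } i,\alpha\in\{1,2\},\ \sigma^i\text{ Pauli matrices})$$ is the only possibility for the Dirac operator of a geometrically realised spectral triple. Moreover, one is forced to $\nabla s^i=0$ and $\nabla_{\mathcal S}e^\alpha=0$ on the bases. This ${\not\!D}$ forms a spectral triple (with hermitian Dirac operator $D=\imath{\not\!D}$) of KO-dimension $n=2$ if one chooses $\epsilon=\epsilon'=\epsilon''=-1$, and of KO-dimension $n=1$ if $\epsilon=\epsilon'=1$, ignoring $\gamma$.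
   Context: **Torus.** $A=\mathbb{C}_\theta[\mathbb{T}^2]$ is the $*$-algebra generated by unitaries $u,v$ with $vu=e^{\imath\theta}uv$, $\theta\in\mathbb{R}$ with $\theta/2\pi$ irrational (so the centre is $\mathbb{C}1$). $\Omega^1$ has relations $(du)u=u\,du$, $(dv)v=v\,dv$, $(dv)u=e^{\imath\theta}u\,dv$, $(du)v=e^{-\imath\theta}v\,du$, with exterior algebra its maximal prolongation. The forms $s^1=-\imath u^{-1}du$, $s^2=-\imath v^{-1}dv$ are a central self-adjoint basis of $\Omega^1$, with $ds^i=0$, $s^i\wedge s^j=-s^j\wedge s^i$. Partial derivatives are defined by $da=(\partial_i a)s^i$, so $\partial_1(u^mv^n)=\imath m\,u^mv^n$, $\partial_2(u^mv^n)=\imath n\,u^mv^n$. **Connections.** A bimodule connection is $\nabla:\Omega^1\to\Omega^1\otimes_A\Omega^1$ with $\nabla(a\omega)=a\nabla\omega+da\otimes\omega$ and $\nabla(\omega a)=(\nabla\omega)a+\sigma(\omega\otimes da)$ for a bimodule map $\sigma$. Here $\sigma$ is necessarily the flip on the $s^i$. Write $\nabla s^i=-\frac12\Gamma^i{}_{jk}s^j\otimes s^k$ with constants $\Gamma^i{}_{jk}$, real by the requirement that $\nabla$ is $*$-preserving. A WQLC is a $*$-preserving bimodule connection that is torsion free ($\wedge\nabla=d$) and cotorsion free ($(d\otimes\mathrm{id}-\mathrm{id}\wedge\nabla)g=0$). **Spinor data.** $\mathcal S$ is free over $A$ with central basis $e^1,e^2$ ($ae^\alpha=e^\alpha a$).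 A bimodule connection on $\mathcal S$ is $\nabla_{\mathcal S}e^\alpha=S^\alpha{}_{i\beta}s^i\otimes e^\beta$, obeying the same two Leibniz rules as $\nabla$, with a bimodule map $\sigma_{\mathcal S}:\mathcal S\otimes_A\Omega^1\to\Omega^1\otimes_A\mathcal S$ in the second; here $\sigma_{\mathcal S}$ is necessarily the flip and $S^\alpha{}_{i\beta}\in\mathbb{C}$. The Clifford action is the bimodule map $\triangleright:\Omega^1\otimes_A\mathcal S\to\mathcal S$ with $s^i\triangleright e^\alpha=C^{i\alpha}{}_\beta e^\beta$, $C^{i\alpha}{}_\beta\in\mathbb{C}$. Charge conjugation is $\mathcal J(ae^\alpha)=a^*J^\alpha{}_\beta e^\beta$, $J^\alpha{}_\beta\in\mathbb{C}$. An even structure (if present) is $\gamma(e^\alpha)=\gamma^\alpha{}_\beta e^\beta$, $\gamma^\alpha{}_\beta\in\mathbb{C}$. We regard $C^i$, $S_i$, $J$, $\gamma$ as matrices with row index $\alpha$ and column index $\beta$; overline is entrywise complex conjugation. The Dirac operator is ${\not\!D}=\triangleright\circ\nabla_{\mathcal S}$, i.e. $({\not\!D}\psi)_\gamma=(\partial_i\psi_\alpha+\psi_\beta S^\beta{}_{i\alpha})C^{i\alpha}{}_\gamma$ for $\psi=\psi_\alpha e^\alpha$. **Local tensorial conditions**, for signs $\epsilon,\epsilon',\epsilon''\in\{\pm1\}$: $\overline JJ=\epsilon\,\mathrm{id}$; $\overline{S_i}J=JS_i$; $\overline{C^i}J=\epsilon'JC^i$; covariance of $\triangleright$: $[C^i,S_j]=-\frac12\Gamma^i{}_{jk}C^k$;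 Clifford relations $C^iC^j+C^jC^i=2\delta^{ij}\mathrm{id}$; and, for $\gamma$: $\gamma^2=\mathrm{id}$, $\{C^i,\gamma\}=0$, $\overline\gamma J=\epsilon''J\gamma$, $[S_i,\gamma]=0$. **Hilbert space conditions.** The standard structure is $\langle\phi_\alpha e^\alpha,\psi_\beta e^\beta\rangle=\int\phi_\alpha^*\psi_\alpha$ (sum over $\alpha$) with $\int u^mv^n=\delta_{m,0}\delta_{n,0}$, completed to a Hilbert space. One requires ${\not\!D}$ antihermitian, $\mathcal J$ an antilinear isometry, and $\gamma$ (if present) hermitian. A geometrically realised spectral triple means data satisfying all the local tensorial and Hilbert space conditions. Unitary equivalence is a change of basis $\{e^\alpha\}$ by a constant unitary matrix $u$: $C^i\mapsto uC^iu^{-1}$, $S_i\mapsto uS_iu^{-1}$, $J\mapsto\overline uJu^{-1}$, $\gamma\mapsto u\gamma u^{-1}$. **KO-dimension signs.** The hermitian operator is $D=\imath{\not\!D}$, so $\mathcal J D=-\epsilon' D\mathcal J$. The signs are ($\mathcal J^2=\epsilon$, $\mathcal JD=\epsilon'_DD\mathcal J$, $\mathcal J\gamma=\epsilon''\gamma\mathcal J$): $n=2$: $(\epsilon,\epsilon'_D,\epsilon'')=(-1,1,-1)$; $n=1$: $(\epsilon,\epsilon'_D)=(1,-1)$. Pauli matrices: $\sigma^1=\begin{pmatrix}0&1\\1&0\end{pmatrix}$, $\sigma^2=\begin{pmatrix}0&-\imath\\\imath&0\end{pmatrix}$, $\sigma^3=\begin{pmatrix}1&0\\0&-1\end{pmatrix}$.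 *)

(* Defs.v *)
From HB Require Import structures.
From mathcomp Require Import all_boot all_order all_algebra.
From mathcomp Require Import finmap complex monalg.
From mathcomp Require Import classical_sets reals trigo.
From mathcomp Require Import ring.

Set Implicit Arguments.
Unset Strict Implicit.
Unset Printing Implicit Defensive.

Import Order.TTheory GRing.Theory Num.Theory.

Local Open Scope fset_scope.
Local Open Scope ring_scope.

(* The algebraic noncommutative torus C_theta[T^2]: finite linear combinations
   of the monomials u^m v^n, indexed by (m, n), multiplied according to
   v u = e^(i theta) u v.  The parameter theta does not occur in the carrier;
   it only selects the algebra structure declared below. *)
Definition qtorus (R : realType) (theta : R) : Type :=
  {malg R[i][(int * int)%type]}.

HB.instance Definition _ (R : realType) (theta : R) :=
  Choice.copy (qtorus theta) {malg R[i][(int * int)%type]}.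

(* The vector space operations are those of {malg _}; they are locked only to
   keep unification from unfolding finitely supported functions. *)
HB.lock Definition qt_zero (R : realType) (theta : R) : qtorus theta :=
  0 : {malg R[i][(int * int)%type]}.
HB.lock Definition qt_add (R : realType) (theta : R) (a b : qtorus theta) :
    qtorus theta :=
  (a : {malg R[i][(int * int)%type]}) + (b : {malg R[i][(int * int)%type]}).
HB.lock Definition qt_opp (R : realType) (theta : R) (a : qtorus theta) :
    qtorus theta :=
  - (a : {malg R[i][(int * int)%type]}).
HB.lock Definition qt_scale (R : realType) (theta : R) (c : R[i])
    (a : qtorus theta) : qtorus theta :=
  c *: (a : {malg R[i][(int * int)%type]}).

Section TorusVectorSpace.
Variables (R : realType) (theta : R).
Local Notation add := (@qt_add R theta).
Local Notation scale := (@qt_scale R theta).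

Lemma qt_addA : associative add.
Proof. by move=> a b c; rewrite unlock; exact: addrA. Qed.

Lemma qt_addC : commutative add.
Proof. by move=> a b; rewrite unlock; exact: addrC. Qed.

Lemma qt_add0 : left_id (qt_zero theta) add.
Proof. by move=> a; rewrite !unlock; exact: add0r. Qed.

Lemma qt_addN : left_inverse (qt_zero theta) (@qt_opp R theta) add.
Proof. by move=> a; rewrite !unlock; exact: addNr. Qed.

HB.instance Definition _ := GRing.isZmodule.Build (qtorus theta)
  qt_addA qt_addC qt_add0 qt_addN.

Lemma qt_scaleA c d a : scale c (scale d a) = scale (c * d) a.
Proof. by rewrite unlock; exact: scalerA. Qed.

Lemma qt_scale1 : left_id 1 scale.
Proof. by move=> a; rewrite unlock; exact: scale1r. Qed.

Lemma qt_scaleDr : right_distributive scale +%R.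
Proof.
by move=> c a b; rewrite /GRing.add /= !unlock; exact: scalerDr.
Qed.

Lemma qt_scaleDl a : {morph scale^~ a : c d / c + d}.
Proof.
by move=> c d; rewrite [in RHS]/GRing.add /= !unlock; exact: scalerDl.
Qed.

HB.instance Definition _ := GRing.Zmodule_isLmodule.Build R[i] (qtorus theta)
  qt_scaleA qt_scale1 qt_scaleDr qt_scaleDl.

Implicit Types (a b : qtorus theta) (k : int * int).

Lemma qt_coef0 k : (0 : qtorus theta)@_k = 0.
Proof. by rewrite /GRing.zero /= unlock; exact: mcoeff0. Qed.

Lemma qt_coefD a b k : (a + b)@_k = a@_k + b@_k.
Proof. by rewrite [in LHS]/GRing.add /= unlock; exact: mcoeffD. Qed.

Lemma qt_coefZ c a k : (c *: a)@_k = c * a@_k.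
Proof. by rewrite [in LHS]/GRing.scale /= unlock; exact: mcoeffZ. Qed.

Lemma qt_supp0 : msupp (0 : qtorus theta) = fset0.
Proof. by rewrite /GRing.zero /= unlock; exact: msupp0. Qed.

Lemma qt_suppD a b : msupp (a + b) `<=` msupp a `|` msupp b.
Proof. by rewrite /GRing.add /= unlock; exact: msuppD_le. Qed.

Lemma qt_eqP a b : (forall k, a@_k = b@_k) -> a = b.
Proof. by move=> eq_ab; apply/malgP. Qed.

End TorusVectorSpace.

Definition qphase (R : realType) (theta : R) : R[i] :=
  (cos theta +i* sin theta)%C.

Lemma qphase_normK (R : realType) (theta : R) :
  (qphase theta)^* * qphase theta = 1.
Proof.
apply/eqP; rewrite eq_complex /= mulNr opprK -!expr2 cos2Dsin2 eqxx.
by rewrite mulNr [sin _ * _]mulrC subrr eqxx.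
Qed.

Lemma qphase_unit (R : realType) (theta : R) : qphase theta \is a GRing.unit.
Proof.
by rewrite unitfE; apply: contra_eq_neq (qphase_normK theta) => ->;
  rewrite mulr0 eq_sym oner_eq0.
Qed.

Lemma qphase_conj (R : realType) (theta : R) (k : int) :
  (qphase theta ^ k)^* = qphase theta ^ (- k).
Proof.
rewrite rmorphXz ?qphase_unit // -exprz_inv.
congr (_ ^ k); apply: (mulIr (qphase_unit theta)).
by rewrite qphase_normK mulVr ?qphase_unit.
Qed.

Lemma qphaseD (R : realType) (theta : R) (k l : int) :
  qphase theta ^ (k + l) = qphase theta ^ k * qphase theta ^ l.
Proof. by rewrite exprzDr ?qphase_unit. Qed.

(* c u^m v^n, for k = (m, n) *)
HB.lock Definition qt_mono (R : realType) (theta : R) (c : R[i])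
  (k : int * int) : qtorus theta := << c *g k >>.
Arguments qt_mono {R} theta c k.

(* (u^m v^n) (u^m' v^n') = e^(i theta n m') u^(m + m') v^(n + n') *)
HB.lock Definition qt_mul (R : realType) (theta : R) (a b : qtorus theta) :
    qtorus theta :=
  \sum_(k <- msupp a) \sum_(l <- msupp b)
    qt_mono theta (a@_k * b@_l * qphase theta ^ (k.2 * l.1))
                  (k.1 + l.1, k.2 + l.2).

(* (u^m v^n)^* = v^(-n) u^(-m) = e^(i theta m n) u^(-m) v^(-n) *)
HB.lock Definition qt_star (R : realType) (theta : R) (a : qtorus theta) :
    qtorus theta :=
  \sum_(k <- msupp a)
    qt_mono theta ((a@_k)^* * qphase theta ^ (k.1 * k.2)) (- k.1, - k.2).

(* partial_1 (u^m v^n) = i m u^m v^n and partial_2 (u^m v^n) = i n u^m v^n *)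
HB.lock Definition qt_partial (R : realType) (theta : R) (i : 'I_2)
    (a : qtorus theta) : qtorus theta :=
  \sum_(k <- msupp a)
    qt_mono theta ('i * (if i == 0 then k.1 else k.2)%:~R * a@_k) k.

Section TorusAlgebra.
Variables (R : realType) (theta : R).
Local Notation C := R[i].
Local Notation A := (qtorus theta).
Local Notation q := (qphase theta).
Local Notation mono := (qt_mono theta).
Local Notation qt_mul := (@qt_mul R theta).
Local Notation qt_star := (@qt_star R theta).
Local Notation qt_partial := (@qt_partial R theta).
Implicit Types (a b : A) (k l : int * int) (c : C).

Lemma qt_coef_mono c k l : (mono c k)@_l = c *+ (k == l).
Proof. by rewrite unlock mcoeffU. Qed.

Lemma qt_mono0 k : mono 0 k = 0.
Proof. by apply: qt_eqP => l; rewrite qt_coef_mono mul0rn qt_coef0. Qed.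

Lemma qt_monoD c c' k : mono (c + c') k = mono c k + mono c' k.
Proof. by apply: qt_eqP => l; rewrite qt_coefD !qt_coef_mono mulrnDl. Qed.

Lemma qt_supp_mono c k : msupp (mono c k) `<=` [fset k].
Proof. by rewrite unlock; exact: msuppU_le. Qed.

Lemma qt_monoE a : a = \sum_(k <- msupp a) mono a@_k k.
Proof.
apply: qt_eqP => l; rewrite [in LHS](monalgE a) raddf_sum /=.
rewrite (big_morph (fun b : A => b@_l) (fun b1 b2 => qt_coefD b1 b2 l) (qt_coef0 theta l)).
by apply: eq_bigr => k _; rewrite unlock.
Qed.

Lemma qt_ind (P : A -> Prop) :
  P 0 -> (forall a b, P a -> P b -> P (a + b)) ->
  (forall c k, P (mono c k)) -> forall a, P a.
Proof.
move=> P0 PD PU a; rewrite [a]qt_monoE.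
by elim: (enum_fset _) => [|k s IHs]; rewrite ?big_nil // big_cons; apply: PD.
Qed.

Lemma qt_mulw (d1 d2 : {fset (int * int)%type}) a b :
  msupp a `<=` d1 -> msupp b `<=` d2 ->
  qt_mul a b = \sum_(k <- d1) \sum_(l <- d2)
    mono (a@_k * b@_l * q ^ (k.2 * l.1)) (k.1 + l.1, k.2 + l.2).
Proof.
move=> le_d1 le_d2; rewrite unlock (big_fset_incl _ le_d1) /=.
  apply/eq_bigr=> k1 _; apply/big_fset_incl => // k _ /mcoeff_outdom ->.
  by rewrite mulr0 mul0r qt_mono0.
move=> k _ /mcoeff_outdom ak0.
by rewrite big1 => // k' _; rewrite ak0 !mul0r qt_mono0.
Qed.

Lemma qt_mulDl : left_distributive qt_mul +%R.
Proof.
move=> a1 a2 b.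
rewrite (qt_mulw (qt_suppD _ _) (fsubset_refl _)).
rewrite (qt_mulw (fsubsetUl _ (msupp a2)) (fsubset_refl _)).
rewrite (qt_mulw (fsubsetUr (msupp a1) _) (fsubset_refl _)) -big_split /=.
apply/eq_bigr=> k1 _; rewrite -big_split /=; apply/eq_bigr=> k2 _.
by rewrite qt_coefD !mulrDl qt_monoD.
Qed.

Lemma qt_mulDr : right_distributive qt_mul +%R.
Proof.
move=> a b1 b2.
rewrite (qt_mulw (fsubset_refl _) (qt_suppD _ _)).
rewrite (qt_mulw (fsubset_refl _) (fsubsetUl _ (msupp b2))).
rewrite (qt_mulw (fsubset_refl _) (fsubsetUr (msupp b1) _)) -big_split /=.
apply/eq_bigr=> k1 _; rewrite -big_split /=; apply/eq_bigr=> k2 _.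
by rewrite qt_coefD mulrDr mulrDl qt_monoD.
Qed.

Lemma qt_mul0l b : qt_mul 0 b = 0.
Proof. by rewrite unlock qt_supp0 big_seq_fset0. Qed.

Lemma qt_mul0r a : qt_mul a 0 = 0.
Proof.
by rewrite unlock big1 // => k _; rewrite qt_supp0 big_seq_fset0.
Qed.

Lemma qt_mul_mono c1 c2 k l :
  qt_mul (mono c1 k) (mono c2 l) =
  mono (c1 * c2 * q ^ (k.2 * l.1)) (k.1 + l.1, k.2 + l.2).
Proof.
rewrite (qt_mulw (qt_supp_mono _ _) (qt_supp_mono _ _)) !big_seq_fset1.
by rewrite !qt_coef_mono !eqxx !mulr1n.
Qed.

Lemma qt_mulA : associative qt_mul.
Proof.
move=> a b c; elim/qt_ind: a => [|a1 a2 h1 h2|ca k].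
- by rewrite 3!qt_mul0l.
- by rewrite 3!qt_mulDl h1 h2.
elim/qt_ind: b => [|a1 a2 h1 h2|cb l].
- by rewrite qt_mul0l qt_mul0r qt_mul0l.
- by rewrite qt_mulDl 2!qt_mulDr qt_mulDl h1 h2.
elim/qt_ind: c => [|a1 a2 h1 h2|cc m].
- by rewrite 3!qt_mul0r.
- by rewrite 3!qt_mulDr h1 h2.
rewrite 4!qt_mul_mono /= 2!addrA; congr qt_mono.
by rewrite mulrDr mulrDl 2!qphaseD; ring.
Qed.

Definition qt_one : A := mono 1 (0, 0).

Lemma qt_mul1l : left_id qt_one qt_mul.
Proof.
elim/qt_ind=> [|a b ha hb|c k]; first by rewrite qt_mul0r.
  by rewrite qt_mulDr ha hb.
by rewrite qt_mul_mono /= mul0r expr0z mulr1 mul1r 2!add0r; case: k.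
Qed.

Lemma qt_mul1r : right_id qt_one qt_mul.
Proof.
elim/qt_ind=> [|a b ha hb|c k]; first by rewrite qt_mul0l.
  by rewrite qt_mulDl ha hb.
by rewrite qt_mul_mono /= mulr0 expr0z 2!mulr1 2!addr0; case: k.
Qed.

Lemma qt_one_neq0 : qt_one != 0.
Proof.
apply/eqP => /(congr1 (fun a : A => a@_(0, 0))) /eqP.
by rewrite qt_coef_mono qt_coef0 eqxx oner_eq0.
Qed.

HB.instance Definition _ := GRing.Zmodule_isNzRing.Build A
  qt_mulA qt_mul1l qt_mul1r qt_mulDl qt_mulDr qt_one_neq0.

Lemma qtM_mono c1 c2 k l :
  mono c1 k * mono c2 l =
  mono (c1 * c2 * q ^ (k.2 * l.1)) (k.1 + l.1, k.2 + l.2).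
Proof. exact: qt_mul_mono. Qed.

Lemma qtZ_mono c c' k : c *: mono c' k = mono (c * c') k.
Proof.
by apply: qt_eqP => l; rewrite qt_coefZ 2!qt_coef_mono mulrnAr.
Qed.

Lemma qt_scaleAl c a b : c *: (a * b) = (c *: a) * b.
Proof.
elim/qt_ind: a => [|a1 a2 h1 h2|ca k]; first by rewrite mul0r scaler0 mul0r.
  by rewrite mulrDl 2!scalerDr h1 h2 mulrDl.
elim/qt_ind: b => [|a1 a2 h1 h2|cb l]; first by rewrite 2!mulr0 scaler0.
  by rewrite 2!mulrDr scalerDr h1 h2.
by rewrite qtZ_mono 2!qtM_mono qtZ_mono !mulrA.
Qed.

HB.instance Definition _ := GRing.Lmodule_isLalgebra.Build C A qt_scaleAl.

Lemma qt_scaleAr c a b : c *: (a * b) = a * (c *: b).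
Proof.
elim/qt_ind: a => [|a1 a2 h1 h2|ca k]; first by rewrite 2!mul0r scaler0.
  by rewrite 2!mulrDl scalerDr h1 h2.
elim/qt_ind: b => [|a1 a2 h1 h2|cb l]; first by rewrite scaler0 mulr0 scaler0.
  by rewrite mulrDr 2!scalerDr h1 h2 mulrDr.
by rewrite qtZ_mono 2!qtM_mono qtZ_mono !mulrA [c * ca]mulrC.
Qed.

HB.instance Definition _ := GRing.Lalgebra_isAlgebra.Build C A qt_scaleAr.

Definition qt_u : A := mono 1 (1, 0).
Definition qt_v : A := mono 1 (0, 1).

(* integer powers of a unitary element *)
Definition qt_pow a (n : int) : A :=
  if n is Posz _ then a ^+ `|n|%N else qt_star a ^+ `|n|%N.

Definition qt_int a : C := a@_(0, 0).

Lemma qt_vu : qt_v * qt_u = q *: (qt_u * qt_v).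
Proof.
rewrite 2!qtM_mono /= qtZ_mono.
by rewrite !(mulr1, mul1r, mulr0, mul0r, addr0, add0r).
Qed.

Lemma qt_star_mono c k :
  qt_star (mono c k) = mono (c^* * q ^ (k.1 * k.2)) (- k.1, - k.2).
Proof.
rewrite unlock (big_fset_incl _ (qt_supp_mono _ _)) /=.
  by rewrite big_seq_fset1 qt_coef_mono eqxx.
by move=> l _ /mcoeff_outdom ->; rewrite rmorph0 mul0r qt_mono0.
Qed.

Lemma qt_star0 : qt_star 0 = 0.
Proof. by rewrite unlock qt_supp0 big_seq_fset0. Qed.

Lemma qt_starD : {morph qt_star : a b / a + b}.
Proof.
have starw (d : {fset (int * int)%type}) a : msupp a `<=` d -> qt_star a =
    \sum_(k <- d) mono ((a@_k)^* * q ^ (k.1 * k.2)) (- k.1, - k.2).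
  move=> le_d; rewrite unlock (big_fset_incl _ le_d) //=.
  by move=> l _ /mcoeff_outdom ->; rewrite rmorph0 mul0r qt_mono0.
move=> a b; rewrite (starw _ _ (qt_suppD _ _)).
rewrite (starw _ _ (fsubsetUl _ (msupp b))).
rewrite (starw _ _ (fsubsetUr (msupp a) _)) -big_split /=.
by apply/eq_bigr=> k _; rewrite qt_coefD rmorphD mulrDl qt_monoD.
Qed.

Lemma qt_starK : involutive qt_star.
Proof.
elim/qt_ind=> [|a b ha hb|c k]; first by rewrite 2!qt_star0.
  by rewrite 2!qt_starD ha hb.
rewrite 2!qt_star_mono /= 2!opprK rmorphM /= conjCK mulrNN qphase_conj.
by rewrite -mulrA -qphaseD addNr expr0z mulr1; case: k.
Qed.

Lemma qt_starM a b : qt_star (a * b) = qt_star b * qt_star a.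
Proof.
elim/qt_ind: a => [|a1 a2 h1 h2|ca k]; first by rewrite mul0r qt_star0 mulr0.
  by rewrite mulrDl 2!qt_starD h1 h2 mulrDr.
elim/qt_ind: b => [|a1 a2 h1 h2|cb l]; first by rewrite mulr0 qt_star0 mul0r.
  by rewrite mulrDr 2!qt_starD h1 h2 mulrDl.
rewrite qtM_mono 3!qt_star_mono qtM_mono /=.
congr qt_mono; last by rewrite 2!opprD ![- l.1 + _]addrC ![- l.2 + _]addrC.
rewrite 2!rmorphM /= qphase_conj mulrNN.
have -> : (k.1 + l.1) * (k.2 + l.2) =
  k.2 * l.1 + (k.1 * k.2 + l.1 * l.2 + l.2 * k.1) by ring.
rewrite 3!qphaseD; have := qphaseD theta (- (k.2 * l.1)) (k.2 * l.1).
rewrite addNr expr0z => qV; rewrite -[RHS]mulr1 qV; ring.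
Qed.

Lemma qt_starZ c a : qt_star (c *: a) = c^* *: qt_star a.
Proof.
elim/qt_ind: a => [|a b ha hb|c' k]; first by rewrite scaler0 qt_star0 scaler0.
  rewrite [c *: _]scalerDr (qt_starD (c *: a)) (qt_starD a) [RHS]scalerDr.
  by congr (_ + _).
by rewrite qtZ_mono 2!qt_star_mono qtZ_mono rmorphM mulrA.
Qed.

Lemma qt_u_unitary : qt_star qt_u * qt_u = 1 /\ qt_u * qt_star qt_u = 1.
Proof.
rewrite qt_star_mono 2!qtM_mono /= rmorph1 !(mul1r, mulr0, mul0r, oppr0).
by rewrite addNr subrr.
Qed.

Lemma qt_v_unitary : qt_star qt_v * qt_v = 1 /\ qt_v * qt_star qt_v = 1.
Proof.
rewrite qt_star_mono 2!qtM_mono /= rmorph1 !(mul1r, mulr0, mul0r, oppr0).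
by rewrite addNr subrr.
Qed.

Lemma qt_mono_pow c k :
  mono c k = c *: (qt_pow qt_u k.1 * qt_pow qt_v k.2).
Proof.
have uX (n : nat) (e : int) : mono 1 (e, 0) ^+ n = mono 1 (n%:Z * e, 0).
  elim: n => [|n IHn]; first by rewrite expr0 mul0r.
  rewrite exprS IHn qtM_mono /= !mul0r expr0z !mul1r addr0.
  by congr (qt_mono _ _ (_, _)); rewrite intS mulrDl mul1r.
have vX (n : nat) (e : int) : mono 1 (0, e) ^+ n = mono 1 (0, n%:Z * e).
  elim: n => [|n IHn]; first by rewrite expr0 mul0r.
  rewrite exprS IHn qtM_mono /= !mulr0 expr0z !mul1r addr0.
  by congr (qt_mono _ _ (_, _)); rewrite intS mulrDl mul1r.
have uE (n : int) : qt_pow qt_u n = mono 1 (n, 0).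
  case: n => n; rewrite /qt_pow ?qt_star_mono /= ?rmorph1 ?mulr0 ?expr0z ?mulr1.
    by rewrite uX mulr1.
  by rewrite oppr0 uX NegzE mulrN1.
have vE (n : int) : qt_pow qt_v n = mono 1 (0, n).
  case: n => n; rewrite /qt_pow ?qt_star_mono /= ?rmorph1 ?mul0r ?expr0z ?mulr1.
    by rewrite vX mulr1.
  by rewrite oppr0 vX NegzE mulrN1.
rewrite uE vE qtM_mono qtZ_mono /= mul0r expr0z !mulr1 addr0 add0r.
by case: k.
Qed.

Lemma qt_partial_mono i c k :
  qt_partial i (mono c k) =
  mono ('i * (if i == 0 then k.1 else k.2)%:~R * c) k.
Proof.
rewrite unlock (big_fset_incl _ (qt_supp_mono _ _)) /=.
  by rewrite big_seq_fset1 qt_coef_mono eqxx.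
by move=> l _ /mcoeff_outdom ->; rewrite mulr0 qt_mono0.
Qed.

Lemma qt_partial0 i : qt_partial i 0 = 0.
Proof. by rewrite unlock qt_supp0 big_seq_fset0. Qed.

Lemma qt_partialD i : {morph qt_partial i : a b / a + b}.
Proof.
have dw (d : {fset (int * int)%type}) a : msupp a `<=` d -> qt_partial i a =
    \sum_(k <- d) mono ('i * (if i == 0 then k.1 else k.2)%:~R * a@_k) k.
  move=> le_d; rewrite unlock (big_fset_incl _ le_d) //=.
  by move=> l _ /mcoeff_outdom ->; rewrite mulr0 qt_mono0.
move=> a b; rewrite (dw _ _ (qt_suppD _ _)).
rewrite (dw _ _ (fsubsetUl _ (msupp b))).
rewrite (dw _ _ (fsubsetUr (msupp a) _)) -big_split /=.
by apply/eq_bigr=> k _; rewrite qt_coefD mulrDr qt_monoD.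
Qed.

Lemma qt_partialM i a b :
  qt_partial i (a * b) = qt_partial i a * b + a * qt_partial i b.
Proof.
elim/qt_ind: a => [|a1 a2 h1 h2|ca k].
- by rewrite mul0r qt_partial0 2!mul0r addr0.
- by rewrite mulrDl 2!qt_partialD h1 h2 2!mulrDl addrACA.
elim/qt_ind: b => [|a1 a2 h1 h2|cb l].
- by rewrite mulr0 qt_partial0 2!mulr0 addr0.
- by rewrite mulrDr 2!qt_partialD h1 h2 2!mulrDr addrACA.
rewrite qtM_mono 3!qt_partial_mono 2!qtM_mono -qt_monoD; congr qt_mono => /=.
by case: (i == 0); rewrite rmorphD /=; ring.
Qed.

End TorusAlgebra.

Arguments qt_u {R} theta.
Arguments qt_v {R} theta.

(* Omega^1, Omega^1 (x)_A Omega^1, Omega^2 and the spinor bundle S are free as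
   left modules on central bases (s^i), (s^j (x) s^k), s^1 /\ s^2 and (e^a), so
   their elements are given by their coordinates on the left of the basis:
     Omega^1 and S                  'rV[A]_2
     X (x)_A Y, X and Y free        'M[A]_(m, n), entry (j, k) the coefficient
                                    of the j-th (x) the k-th basis element
     Omega^2                        A
   The left action is a *: X; as the bases are central, the right action
   multiplies the coordinates by a on the right. *)
Section Calculus.
Variables (R : realType) (theta : R).
Local Notation C := R[i].
Local Notation A := (qtorus theta).

Definition rscale m n (X : 'M[A]_(m, n)) (a : A) : 'M[A]_(m, n) :=
  map_mx (fun x => x * a) X.

Definition scalmx m n (M : 'M[C]_(m, n)) : 'M[A]_(m, n) := map_mx (in_alg A) M.

Definition starmx m n (X : 'M[A]_(m, n)) : 'M[A]_(m, n) :=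
  map_mx (@qt_star R theta) X.

Definition tens m n (x : 'rV[A]_m) (y : 'rV[A]_n) : 'M[A]_(m, n) :=
  \matrix_(j, k) (x 0 j * y 0 k).

Definition basis n (i : 'I_n) : 'rV[A]_n := delta_mx 0 i.

Definition qt_d (a : A) : 'rV[A]_2 := \row_i qt_partial i a.

Definition wedge (X : 'M[A]_2) : A := X 0 1 - X 1 0.

(* d (w_i s^i) = d w_i /\ s^i, since d s^i = 0 *)
Definition qt_d1 (w : 'rV[A]_2) : A :=
  wedge (\sum_i tens (qt_d (w 0 i)) (basis i)).

Lemma qt_dM a b : qt_d (a * b) = a *: qt_d b + rscale (qt_d a) b.
Proof. by apply/rowP => i; rewrite !mxE qt_partialM addrC. Qed.

Lemma qt_ddE a : qt_d1 (qt_d a) = 0.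
Proof.
rewrite /qt_d1 /wedge !summxE !big_ord_recl !big_ord0 !mxE /= !mulr0.
rewrite !mulr1 !addr0 !add0r.
elim/qt_ind: a => [|a1 a2 h1 h2|c k]; first by rewrite !qt_partial0 subrr.
  by rewrite !qt_partialD opprD addrACA h1 h2 addr0.
rewrite !qt_partial_mono /=; apply/eqP; rewrite subr_eq0; apply/eqP.
by congr qt_mono; ring.
Qed.

Section Omega1.
Let u := qt_u theta.
Let v := qt_v theta.
Let du := qt_d u.
Let dv := qt_d v.

(* s^1 = - i u^-1 du and s^2 = - i v^-1 dv *)
Lemma basis_u : basis 0 = (- 'i : C)%:A *: (qt_star u *: du).
Proof.
apply/rowP => i; rewrite !mxE qt_star_mono qt_partial_mono qtM_mono -scalerAl.
rewrite mul1r qtZ_mono /= rmorph1.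
rewrite !(mulr0, oppr0, mul1r, mulr1, expr0z, addr0, addNr).
case: (i == 0); last by rewrite !mulr0 qt_mono0.
by rewrite mulr1 mulNr -expr2 sqrCi opprK.
Qed.

Lemma basis_v : basis 1 = (- 'i : C)%:A *: (qt_star v *: dv).
Proof.
apply/rowP => i; rewrite !mxE qt_star_mono qt_partial_mono qtM_mono -scalerAl.
rewrite mul1r qtZ_mono /= rmorph1.
rewrite !(mulr0, mul0r, oppr0, mul1r, mulr1, expr0z, addr0, addNr).
have -> : (i == 1) = (i != 0) by case: i => [[|[|]]].
case: (i == 0); first by rewrite !mulr0 qt_mono0.
by rewrite mulr1 mulNr -expr2 sqrCi opprK.
Qed.

Lemma omega1_rels :
  [/\ rscale du u = u *: du, rscale dv v = v *: dv,
      rscale dv u = qphase theta *: u *: dv &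
      rscale du v = (qphase theta)^-1 *: v *: du].
Proof.
have qV := qphase_unit theta.
split; apply/rowP => i; rewrite !mxE !qt_partial_mono ?qtZ_mono !qtM_mono /=;
  rewrite !(mulr0, mul0r, mulr1, mul1r, expr0z, addr0, add0r) //.
- congr qt_mono; ring.
- by congr qt_mono; rewrite expr1z mulrAC mulVr ?mul1r.
Qed.

End Omega1.

Record bimodule_map m n p r (f : 'M[A]_(m, n) -> 'M[A]_(p, r)) : Prop :=
  BimoduleMap {
    bimodule_mapD : {morph f : x y / x + y};
    bimodule_mapl : forall a x, f (a *: x) = a *: f x;
    bimodule_mapr : forall x a, f (rscale x a) = rscale (f x) a }.

(* nabla : E -> Omega^1 (x)_A E, for E of rank n, together with
   sigma : E (x)_A Omega^1 -> Omega^1 (x)_A E *)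
Record bimodule_connection n (nabla : 'rV[A]_n -> 'M[A]_(2, n))
    (sigma : 'M[A]_(n, 2) -> 'M[A]_(2, n)) : Prop := BimoduleConnection {
  connection_sigma : bimodule_map sigma;
  connectionD : {morph nabla : x y / x + y};
  connectionl : forall a x, nabla (a *: x) = a *: nabla x + tens (qt_d a) x;
  connectionr : forall x a,
    nabla (rscale x a) = rscale (nabla x) a + sigma (tens x (qt_d a)) }.

(* nabla (w^* ) = sigma ((nabla w)^dagger), where the s^i are self-adjoint and
   (w (x) w')^dagger = w'^* (x) w^* *)
Definition star_preserving (nabla sigma : _ -> 'M[A]_2) : Prop :=
  forall w : 'rV[A]_2, nabla (starmx w) = sigma (starmx (nabla w)^T).

Definition torsion_free (nabla : 'rV[A]_2 -> 'M[A]_2) : Prop :=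
  forall w, wedge (nabla w) = qt_d1 w.

(* g = s^1 (x) s^1 + s^2 (x) s^2 *)
Definition metric : 'M[A]_2 := \sum_i tens (basis i) (basis i).

(* (d (x) id - id /\ nabla) X in Omega^2 (x)_A Omega^1, for
   X = \sum_k w_k (x) s^k; the k-th coordinate is that of s^1 /\ s^2 (x) s^k. *)
Definition cotorsion (nabla : 'rV[A]_2 -> 'M[A]_2) (X : 'M[A]_2) : 'rV[A]_2 :=
  let w k : 'rV[A]_2 := (col k X)^T in
  let wedgel (x : 'rV[A]_2) (Y : 'M[A]_2) : 'rV[A]_2 :=
    \row_k wedge (tens x (col k Y)^T) in
  \sum_k (qt_d1 (w k) *: basis k - wedgel (w k) (nabla (basis k))).

Definition WQLC (nabla : 'rV[A]_2 -> 'M[A]_2) : Prop :=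
  exists sigma, [/\ bimodule_connection nabla sigma,
    star_preserving nabla sigma, torsion_free nabla &
    cotorsion nabla metric = 0].

(* The coefficients Gamma^i_jk of nabla s^i = - 1/2 Gamma^i_jk s^j (x) s^k and
   S^a_ib of nabla_S e^a = S^a_ib s^i (x) e^b.  They are a priori elements of
   A: that they are scalars is a consequence of the bimodule connection axioms
   when theta / 2 pi is irrational. *)
Definition Gamma (nabla : 'rV[A]_2 -> 'M[A]_2) (i j k : 'I_2) : A :=
  - (2%:R : C) *: nabla (basis i) j k.

Definition Scoef (nablaS : 'rV[A]_2 -> 'M[A]_2) (i : 'I_2) : 'M[A]_2 :=
  \matrix_(a, b) nablaS (basis a) i b.

Record spinor_data : Type := SpinorData {
  nabla : 'rV[A]_2 -> 'M[A]_2;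
  nablaS : 'rV[A]_2 -> 'M[A]_2;
  Cliff : 'I_2 -> 'M[C]_2;
  Jmat : 'M[C]_2;
  gam : option 'M[C]_2 }.

(* s^i |> e^a = C^ia_b e^b, extended as a bimodule map *)
Definition clifford (Cl : 'I_2 -> 'M[C]_2) (X : 'M[A]_2) : 'rV[A]_2 :=
  \sum_i row i X *m scalmx (Cl i).

Definition dirac_op (T : spinor_data) (psi : 'rV[A]_2) : 'rV[A]_2 :=
  clifford (Cliff T) (nablaS T psi).

Definition charge_conj (J : 'M[C]_2) (psi : 'rV[A]_2) : 'rV[A]_2 :=
  starmx psi *m scalmx J.

Definition grading (g : 'M[C]_2) (psi : 'rV[A]_2) : 'rV[A]_2 :=
  psi *m scalmx g.

Definition is_sign (eps : C) : Prop := eps = 1 \/ eps = -1.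

Local Notation conjmx := (map_mx (Num.conj : C -> C)).

(* On scalar entries starmx is entrywise complex conjugation. *)
Definition local_conditions (eps eps' eps'' : C) (T : spinor_data) : Prop :=
  let Cl := Cliff T in let J := Jmat T in
  let S := Scoef (nablaS T) in let G := Gamma (nabla T) in
  [/\ conjmx J *m J = eps%:M,
      forall i, starmx (S i) *m scalmx J = scalmx J *m S i,
      forall i, conjmx (Cl i) *m J = eps' *: (J *m Cl i),
      forall i j, scalmx (Cl i) *m S j - S j *m scalmx (Cl i) =
        \sum_k (- (2%:R^-1 : C) *: G i j k) *: scalmx (Cl k) &
      forall i j, Cl i *m Cl j + Cl j *m Cl i = ((i == j)%:R *+ 2)%:M] /\
  (if gam T is Some g then
     [/\ g *m g = 1%:M,
         forall i, Cl i *m g + g *m Cl i = 0,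
         conjmx g *m J = eps'' *: (J *m g) &
         forall i, S i *m scalmx g = scalmx g *m S i]
   else True).

Definition ip (phi psi : 'rV[A]_2) : C :=
  qt_int (\sum_a qt_star (phi 0 a) * psi 0 a).

(* S is dense in the Hilbert space, and the domain of the Dirac operator; the
   isometry condition and hermiticity of the grading extend by continuity. *)
Definition antihermitian_op (D : 'rV[A]_2 -> 'rV[A]_2) : Prop :=
  forall phi psi, ip phi (D psi) = - ip (D phi) psi.

Definition hermitian_op (D : 'rV[A]_2 -> 'rV[A]_2) : Prop :=
  forall phi psi, ip phi (D psi) = ip (D phi) psi.

Definition antilinear_isometry (f : 'rV[A]_2 -> 'rV[A]_2) : Prop :=
  [/\ {morph f : phi psi / phi + psi},
      forall (c : C) phi, f (c%:A *: phi) = (c^*)%:A *: f phi &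
      forall phi psi, ip (f phi) (f psi) = (ip phi psi)^*].

Definition hilbert_conditions (T : spinor_data) : Prop :=
  [/\ antihermitian_op (dirac_op T), antilinear_isometry (charge_conj (Jmat T)) &
      if gam T is Some g then hermitian_op (grading g) else True].

Definition geom_realised (eps eps' eps'' : C) (T : spinor_data) : Prop :=
  [/\ is_sign eps, is_sign eps' & is_sign eps''] /\
  [/\ WQLC (nabla T), exists sigmaS, bimodule_connection (nablaS T) sigmaS,
      local_conditions eps eps' eps'' T & hilbert_conditions T].

(* In the basis e'^a = u^a_b e^b, a spinor with coordinates psi has coordinates
   psi *m u in the original basis, and the coefficients S_i of nabla_S become
   u S_i u^-1. *)
Definition change_basis (u : 'M[C]_2) (T : spinor_data) : spinor_data :=
  SpinorData (nabla T)
    (fun psi => nablaS T (psi *m scalmx u) *m scalmx (invmx u))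
    (fun i => u *m Cliff T i *m invmx u)
    (conjmx u *m Jmat T *m invmx u)
    (omap (fun g => u *m g *m invmx u) (gam T)).

Definition pauli (i : 'I_2) : 'M[C]_2 :=
  \matrix_(a, b)
    if i == 0 then (a != b)%:R
    else if a == b then 0 else if a == 0 then - 'i else 'i.

Definition pauli_dirac (psi : 'rV[A]_2) : 'rV[A]_2 :=
  \row_b \sum_i \sum_a pauli i a b *: qt_partial i (psi 0 a).

Definition dirac_herm (T : spinor_data) (psi : 'rV[A]_2) : 'rV[A]_2 :=
  ('i : C)%:A *: dirac_op T psi.

(* J^2 = eps and J D = epsD D J *)
Definition real_signs (eps epsD : C) (T : spinor_data) : Prop :=
  let JJ := charge_conj (Jmat T) in let D := dirac_herm T in
  (forall psi, JJ (JJ psi) = eps%:A *: psi) /\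
  (forall psi, JJ (D psi) = epsD%:A *: D (JJ psi)).

(* J gamma = eps'' gamma J *)
Definition even_sign (eps'' : C) (T : spinor_data) : Prop :=
  exists2 g, gam T = Some g &
    forall psi, charge_conj (Jmat T) (grading g psi) =
                eps''%:A *: grading g (charge_conj (Jmat T) psi).

Definition KO_dim2 (T : spinor_data) : Prop :=
  real_signs (-1) 1 T /\ even_sign (-1) T.

Definition KO_dim1 (T : spinor_data) : Prop := real_signs 1 (-1) T.

End Calculus.

(* Main.v *)
Require Import Defs.
From mathcomp Require Import all_boot all_order all_algebra.
From mathcomp Require Import complex classical_sets reals trigo monalg ring.

Set Implicit Arguments.
Unset Strict Implicit.
Unset Printing Implicit Defensive.

Import Order.TTheory GRing.Theory Num.Theory.

Local Open Scope ring_scope.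

(** Everything reduces to two by two complex matrices.

    Reduction to matrices.  The basis elements [s^i] and [e^a] are central, so
    the two Leibniz rules of a bimodule connection, compared on [u] and on [v],
    say that the commutator of a coefficient of the connection with [u] is a
    scalar multiple of [u], and likewise for [v].  As [theta / 2 pi] is
    irrational, conjugation by [u] or by [v] multiplies each monomial [u^m v^n]
    with [(m, n) <> (0, 0)] by a nontrivial phase; hence the coefficients are
    scalars ([connection_scalar]).
    Testing the antihermitian Dirac operator on the plane waves [1], [u] and
    [v] shows that the Clifford matrices [c^i] are hermitian and that
    [\sum_i S_i c^i] is antihermitian ([antihermitian_symbol]).

    Flatness of [nabla].  Vanishing torsion and cotorsion make the coefficients
    of [nabla s^i] symmetric in all three indices ([WQLC_symm]).  Covariance of
    the Clifford action writes them as [tr (c^k [c^i, S_j]) / 2], which is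
    antisymmetric in [i] and [k].  So they vanish ([covariant_symm_eq0]).

    Flatness of the spinor connection.  Now [S_j] commutes with the [c^i], and
    the spinor representation is irreducible, so [S_j] is a scalar [s_j]; it is
    real because it commutes with the charge conjugation.  Then
    [\sum_i s_i c^i] is at once hermitian and antihermitian, hence zero, and the
    [c^i] are linearly independent ([invariant_real_eq0]).

    Normal form.  Two anticommuting hermitian matrices with square one are the
    first two Pauli matrices in the orthonormal basis [f, f c^1], for [f] a unit
    vector of positive chirality ([clifford_pauli_frame]).

    Conversely, flat connections and the Pauli matrices satisfy all the
    conditions for suitable matrices [J] ([pauli_triple_realised]); the signs
    can be read off from the matrix identities ([geom_realised_signs]).

    Matrix indices start at zero: the forms [s^1], [s^2] and the matrices
    [c^1], [c^2] have the indices [0] and [1]. *)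

(** * Pauli matrices and Clifford pairs *)

Definition clifford_rel (F : pzRingType) (c : 'I_2 -> 'M[F]_2) : Prop :=
  forall i j, c i *m c j + c j *m c i = ((i == j)%:R *+ 2)%:M.

Lemma ord2P (P : 'I_2 -> Prop) : P 0 -> P 1 -> forall i, P i.
Proof.
move=> P0 P1 [[|[|i]] lt_i2] //.
  by rewrite (_ : Ordinal _ = 0) //; apply: val_inj.
by rewrite (_ : Ordinal _ = 1) //; apply: val_inj.
Qed.

Lemma mx2P (T : Type) (M N : 'M[T]_2) :
  M 0 0 = N 0 0 -> M 0 1 = N 0 1 -> M 1 0 = N 1 0 -> M 1 1 = N 1 1 -> M = N.
Proof. by move=> *; apply/matrixP; elim/ord2P; elim/ord2P. Qed.

(* identities between explicit two by two matrices, entry by entry *)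
Ltac mx2 := apply: mx2P;
  rewrite !(mxE, big_ord_recl, big_ord0) /= ?(mxE, big_ord_recl, big_ord0) /=.

Section CliffordPair.
Local Open Scope sesquilinear_scope.
Variables (F : numClosedFieldType) (c : 'I_2 -> 'M[F]_2).
Hypothesis c_rel : clifford_rel c.

Lemma clifford_sqr i : c i *m c i = 1%:M.
Proof.
have /(congr1 ( *:%R (2^-1 : F))) := c_rel i i.
rewrite eqxx -mulr2n -scaler_nat scalerA mulVf ?pnatr_eq0 // scale1r => ->.
by rewrite scale_scalar_mx mulVf ?pnatr_eq0.
Qed.

Lemma clifford_anti : c 1 *m c 0 = - (c 0 *m c 1).
Proof.
apply/eqP; rewrite -addr_eq0 c_rel /=.
by rewrite mul0rn raddf0.
Qed.

Lemma clifford_trace i k : \tr (c i *m c k) = (i == k)%:R *+ 2.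
Proof.
have /(congr1 mxtrace) := c_rel i k.
rewrite raddfD /= [\tr (c k *m _)]mxtrace_mulC mxtrace_scalar -[LHS]mulr2n.
by rewrite !mulr2n => /eqP; rewrite -!mulr2n eqrMn2r // => /eqP.
Qed.

(** Since [tr (c^k c^l)] is [2] or [0], pairing the covariance condition with
    [c^k] isolates [G i j k].  The trace is cyclic, so that
    [tr (c^k [c^i, S_j]) = tr ([c^k, c^i] S_j)] is antisymmetric in [i] and [k],
    while [G] is symmetric in these indices. *)
Lemma covariant_symm_eq0 (S : 'I_2 -> 'M[F]_2) (G : 'I_2 -> 'I_2 -> 'I_2 -> F) :
  (forall i j, c i *m S j - S j *m c i = \sum_k G i j k *: c k) ->
  (forall i j k, G i j k = G k j i) -> forall i j k, G i j k = 0.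
Proof.
move=> cov symG i j k.
have trE i' k' : \tr (c k' *m (c i' *m S j - S j *m c i')) = G i' j k' *+ 2.
  rewrite cov mulmx_sumr raddf_sum /= (bigD1 k') //= big1 ?addr0.
    by rewrite -scalemxAr mxtraceZ clifford_trace eqxx mulr_natr.
  move=> l /negPf nl.
  by rewrite -scalemxAr mxtraceZ clifford_trace eq_sym nl mul0rn mulr0.
have anti : G k j i *+ 2 = - (G i j k *+ 2).
  rewrite -!trE !mulmxBr !raddfB /= opprK !mulmxA.
  rewrite [\tr (c i *m S j *m _)]mxtrace_mulC [\tr (c k *m S j *m _)]mxtrace_mulC.
  by rewrite !mulmxA addrC.
move/eqP: anti; rewrite -(symG i j k) -addr_eq0 -mulr2n -mulrnA mulrn_eq0.
by move/eqP.
Qed.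

(** The factor [- i] makes the product of the generators hermitian, with square
    one; for the Pauli matrices this is the third one. *)
Definition chirality : 'M[F]_2 := - 'i *: (c 0 *m c 1).

Lemma chirality_anti i : c i *m chirality = - (chirality *m c i).
Proof.
rewrite /chirality -scalemxAr -scalemxAl -scalerN; congr (_ *: _).
move: i; elim/ord2P; first by rewrite -mulmxA clifford_anti mulmxN opprK.
by rewrite mulmxA clifford_anti mulNmx.
Qed.

Lemma chirality_sqr : chirality *m chirality = 1%:M.
Proof.
rewrite /chirality -scalemxAr -scalemxAl scalerA mulrNN -expr2 sqrCi scaleN1r.
rewrite mulmxA -[c 0 *m c 1 *m c 0]mulmxA clifford_anti mulmxN mulNmx opprK.
by rewrite mulmxA clifford_sqr mul1mx clifford_sqr.
Qed.

Lemma clifford_chirality : c 1 = 'i *: (c 0 *m chirality).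
Proof.
rewrite /chirality -scalemxAr scalerA mulrN -expr2 sqrCi opprK scale1r.
by rewrite mulmxA clifford_sqr mul1mx.
Qed.

Lemma chirality_neqN1 : 1%:M + chirality != 0.
Proof.
apply/eqP=> /eqP; rewrite addrC addr_eq0 => /eqP gE.
have := chirality_anti 0; rewrite gE mulmxN mulNmx mulmx1 mul1mx opprK => /eqP.
rewrite eq_sym -addr_eq0 -mulr2n -scaler_nat scaler_eq0 pnatr_eq0 /= => /eqP c0.
have := clifford_sqr 0; rewrite c0 mul0mx => /matrixP /(_ 0 0) /eqP.
by rewrite !mxE eqxx eq_sym oner_eq0.
Qed.

Hypothesis c_herm : forall i, (c i)^t* = c i.

Lemma chirality_herm : chirality^t* = chirality.
Proof.
rewrite /chirality linearZ /= map_mxZ trmx_mul map_mxM !c_herm /=.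
by rewrite clifford_anti scalerN -scaleNr rmorphN /= conjCi opprK.
Qed.

(** As the chirality has square one, it fixes the rows of [1 + chirality]; they
    are not all zero because the chirality anticommutes with [c 0]. *)
Lemma chirality_unit_vector :
  exists2 f : 'rV[F]_2, f *m chirality = f & f *m f^t* = 1%:M.
Proof.
have [i fi0] : exists i, row i (1%:M + chirality) != 0.
  apply/existsP; apply: contraNT chirality_neqN1.
  rewrite negb_exists => /forallP r0; apply/eqP/row_matrixP=> i.
  by have /negPn/eqP := r0 i; rewrite row0.
set f := row i _ in fi0.
have fg : f *m chirality = f.
  by rewrite /f -row_mul mulmxDl mul1mx chirality_sqr addrC.
have n_gt0 : 0 < (f *m f^t*) 0 0.
  rewrite lt0r; apply/andP; split.
    apply: contra fi0 => /eqP; rewrite !mxE => n0.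
    have nn j : true -> 0 <= f 0 j * (f^t*) j 0.
      by rewrite !mxE mul_conjC_ge0.
    move/eqP: n0; rewrite psumr_eq0 // => /allP n0.
    apply/eqP/rowP => j; have := n0 j (mem_index_enum j).
    by rewrite !mxE mul_conjC_eq0 => /eqP.
  by rewrite !mxE sumr_ge0 // => j _; rewrite !mxE mul_conjC_ge0.
exists ((sqrtC ((f *m f^t*) 0 0))^-1 *: f); first by rewrite -scalemxAl fg.
rewrite linearZ map_mxZ /= -scalemxAr -scalemxAl scalerA.
set n := (f *m f^t*) 0 0 in n_gt0 *.
rewrite conj_Creal; last by rewrite rpredV ger0_real // sqrtC_ge0 ltW.
rewrite -invfM -expr2 sqrtCK [f *m _]mx11_scalar -/n scale_scalar_mx.
by rewrite mulVf // gt_eqF.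
Qed.

(** The rows of [u] are [f] and [f *m c 0], where [f] is a unit vector of
    positive chirality.  They have opposite chirality, hence are orthogonal, and
    [c 1] acts on them as ['i *: c 0 *m chirality]. *)
Lemma clifford_pauli_rows : exists2 u : 'M[F]_2, u \is unitarymx &
  [/\ row 0 u *m c 0 = row 1 u, row 1 u *m c 0 = row 0 u,
      row 0 u *m c 1 = - 'i *: row 1 u & row 1 u *m c 1 = 'i *: row 0 u].
Proof.
have [f fg f1] := chirality_unit_vector.
pose u : 'M[F]_2 := \matrix_(i < 2) if i == 0 then f else f *m c 0.
have u0 : row 0 u = f by rewrite rowK.
have u1 : row 1 u = f *m c 0 by rewrite rowK.
have gf : chirality *m f^t* = f^t*.
  by rewrite -[in RHS]fg trmx_mul map_mxM chirality_herm.
have orth : f *m c 0 *m f^t* = 0.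
  have : f *m (chirality *m c 0) *m f^t* = - (f *m (c 0 *m chirality) *m f^t*).
    by rewrite chirality_anti mulmxN mulNmx opprK.
  rewrite !mulmxA fg -[_ *m chirality *m _]mulmxA gf => /eqP.
  by rewrite -addr_eq0 -mulr2n -scaler_nat scaler_eq0 pnatr_eq0 => /eqP.
have orth' : f *m (f *m c 0)^t* = 0.
  by rewrite trmx_mul map_mxM c_herm mulmxA.
exists u; last first.
  rewrite u0 u1 -mulmxA clifford_sqr mulmx1; split=> //.
    rewrite clifford_chirality -scalemxAr chirality_anti mulmxN mulmxA fg.
    by rewrite scalerN scaleNr.
  rewrite clifford_chirality -scalemxAr -mulmxA.
  by rewrite (mulmxA (c 0)) clifford_sqr mul1mx fg.
apply/unitarymxP/matrixP=> i j; rewrite !mxE.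
have -> : \sum_k u i k * u^t* k j = (row i u *m (row j u)^t*) 0 0.
  by rewrite mxE; apply: eq_bigr => k _; rewrite !mxE.
have diag1 : f *m c 0 *m (f *m c 0)^t* = 1%:M.
  rewrite trmx_mul map_mxM c_herm mulmxA.
  by rewrite -(mulmxA f) clifford_sqr mulmx1.
by move: i j; elim/ord2P; elim/ord2P; rewrite ?u0 ?u1 ?f1 ?diag1 ?orth ?orth' mxE.
Qed.

End CliffordPair.

Section Pauli.
Local Open Scope sesquilinear_scope.
Variable R : realType.
Local Notation C := R[i].
Local Notation conjmx := (map_mx (Num.conj : C -> C)).

Lemma pauli_clifford : clifford_rel (pauli R).
Proof.
elim/ord2P; elim/ord2P; mx2; rewrite ?mulrN ?mulNr -?expr2 ?sqrCi; ring.
Qed.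

Lemma pauli_herm i : (pauli R i)^t* = pauli R i.
Proof.
move: i; elim/ord2P; mx2; rewrite ?rmorph0 ?rmorph1 ?rmorphN /= ?conjCi //.
by rewrite opprK.
Qed.

Lemma conj_pauli0 : conjmx (pauli R 0) = pauli R 0.
Proof. by mx2; rewrite ?rmorph0 ?rmorph1. Qed.

Lemma conj_pauli1 : conjmx (pauli R 1) = - pauli R 1.
Proof. by mx2; rewrite ?rmorph0 ?rmorphN ?oppr0 /= ?conjCi ?opprK. Qed.

Lemma pauli_commutant (M : 'M[C]_2) :
  (forall i, pauli R i *m M = M *m pauli R i) -> exists s, M = s%:M.
Proof.
move=> comm; exists (M 0 0).
have /matrixP c0 := comm 0; have /matrixP c1 := comm 1.
have := c0 0 0; have := c0 0 1; have := c1 0 0.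
rewrite !(mxE, big_ord_recl, big_ord0) /= ?(mxE, big_ord_recl, big_ord0) /=.
rewrite !(mul0r, mulr0, mul1r, mulr1, add0r, addr0).
rewrite (_ : lift 0 0 = 1 :> 'I_2); last exact: val_inj.
move=> /eqP; rewrite mulNr mulrC -subr_eq0 -opprD oppr_eq0 -mulrDl mulf_eq0.
rewrite (negPf (neq0Ci _)) orbF addr_eq0 => /eqP e1 e2 e3.
have M01 : M 0 1 = 0.
  move/eqP: e3; rewrite e1 eq_sym -addr_eq0 -mulr2n mulrn_eq0.
  by move/eqP.
by apply: mx2P; rewrite ?mxE /= ?e2 // e1 M01 oppr0.
Qed.

Section CliffordFrame.
Variable c : 'I_2 -> 'M[C]_2.
Hypotheses (c_rel : clifford_rel c) (c_herm : forall i, (c i)^t* = c i).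

Lemma clifford_pauli_frame : exists2 u : 'M[C]_2, u \is unitarymx &
  forall i, u *m c i *m invmx u = pauli R i.
Proof.
have [u uu [r0 r1 r2 r3]] := clifford_pauli_rows c_rel c_herm.
exists u => // i; have u_unit := unitarymx_unit uu.
suff -> : u *m c i = pauli R i *m u by rewrite mulmxK.
apply/row_matrixP => j; rewrite !row_mul [RHS]mulmx_sum_row.
move: i j; elim/ord2P; elim/ord2P; rewrite ?r0 ?r1 ?r2 ?r3.
all: rewrite !(mxE, big_ord_recl, big_ord0) /=.
all: rewrite (_ : lift 0 0 = 1 :> 'I_2); last exact: val_inj.
all: by rewrite !(scale0r, scale1r, add0r, addr0).
Qed.

(** Irreducibility of the spinor representation, read off in the Pauli basis. *)
Lemma clifford_commutant (M : 'M[C]_2) :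
  (forall i, c i *m M = M *m c i) -> exists s, M = s%:M.
Proof.
move=> comm; have [u uu cE] := clifford_pauli_frame.
have u_unit := unitarymx_unit uu.
have [i|s sE] := @pauli_commutant (u *m M *m invmx u).
  rewrite -cE !mulmxA !mulmxKV // -!mulmxA; congr (_ *m _).
  by rewrite !mulmxA comm.
exists s; rewrite -[M](mulKmx u_unit) -[u *m M](mulmxKV u_unit) sE.
by rewrite mulmxA scalar_mxC -mulmxA mulVmx // mulmx1.
Qed.

(** By irreducibility an invariant [S i] is a scalar [s_i], which the real
    structure makes real; so [\sum_i s_i c^i] is both hermitian and
    antihermitian, hence zero, and the [c^i] are linearly independent. *)
Lemma invariant_real_eq0 (S : 'I_2 -> 'M[C]_2) (J : 'M[C]_2) :
  (forall i j, c i *m S j = S j *m c i) ->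
  J \in unitmx -> (forall i, conjmx (S i) *m J = J *m S i) ->
  (\sum_i S i *m c i)^t* = - \sum_i S i *m c i ->
  forall i, S i = 0.
Proof.
move=> comm J_unit realS anti.
have [s sE] : exists s : 'I_2 -> C, forall i, S i = (s i)%:M.
  have /fin_all_exists[s sE] i : exists s, S i = s%:M.
    by apply: clifford_commutant => k; apply: comm.
  by exists s.
have s_real i : (s i)^* = s i.
  move: (realS i); rewrite sE map_scalar_mx /= scalar_mxC.
  move/(congr1 (mulmx^~ (invmx J))); rewrite !mulmxK //.
  by move=> /matrixP/(_ 0 0); rewrite !mxE eqxx !mulr1n.
have BE : \sum_i S i *m c i = \sum_i s i *: c i.
  by apply: eq_bigr => i _; rewrite sE mul_scalar_mx.
have B0 : \sum_i s i *: c i = 0.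
  move: anti; rewrite BE raddf_sum /= map_mx_sum /=.
  under eq_bigr do rewrite linearZ /= map_mxZ /= s_real c_herm.
  by move/eqP; rewrite -addr_eq0 -mulr2n -scaler_nat scaler_eq0 pnatr_eq0
    => /eqP.
move=> i; rewrite sE; suff -> : s i = 0 by rewrite raddf0.
(* the trace form isolates the coefficient of [c i] *)
move: B0 => /(congr1 (fun B => \tr (B *m c i))) /=.
rewrite mul0mx raddf0 mulmx_suml raddf_sum /= (bigD1 i) //= big1.
  by rewrite addr0 -scalemxAl mxtraceZ clifford_trace // eqxx => /eqP;
    rewrite mulf_eq0 pnatr_eq0 orbF => /eqP.
move=> k /negPf ki.
by rewrite -scalemxAl mxtraceZ clifford_trace // ki mul0rn mulr0.
Qed.

End CliffordFrame.
End Pauli.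

(** * The irrational rotation algebra has trivial centre *)

Lemma cosDz2pi (R : realType) (x : R) (k : int) : cos (x + pi *+ 2 *~ k) = cos x.
Proof.
case: k => n; first exact: (periodicn (@cosD2pi R)).
rewrite NegzE mulrNz -pmulrn -[LHS](periodicn (@cosD2pi R) n.+1).
by rewrite subrK.
Qed.

(** Subtracting a multiple of [2 pi] leaves [2 y] with [0 <= y < pi].  From
    [cos (2 y) = 1] follows [sin y = 0], and the sine is positive inside that
    interval. *)
Lemma cos_eq1 (R : realType) (x : R) :
  cos x = 1 -> exists k : int, x = pi *+ 2 *~ k.
Proof.
have pi2_gt0 : 0 < pi *+ 2 :> R by rewrite mulrn_wgt0 ?pi_gt0.
move=> cx; pose k := Num.floor (x / (pi *+ 2)); exists k.
pose y := (x - pi *+ 2 *~ k) / 2.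
have /andP[y_ge0 y_lt] : 0 <= y < pi.
  have /andP[kx xk] := floor_itv (x / (pi *+ 2)).
  rewrite divr_ge0 //=; last first.
    rewrite subr_ge0; move: kx; rewrite ler_pdivlMr //.
    by rewrite -/k mulrzl.
  rewrite ltr_pdivrMr // mulr_natr ltrBlDr.
  by move: xk; rewrite ltr_pdivrMr // -/k rmorphD /= mulrDl mul1r mulrzl addrC.
have sy : sin y = 0.
  have : cos (y *+ 2) = 1.
    by rewrite -mulr_natr /y mulfVK ?pnatr_eq0 // -mulrNz cosDz2pi.
  rewrite cos_mulr2n => /eqP; rewrite subr_eq -mulr2n eqrMn2r //= => /eqP cy2.
  by apply/eqP; rewrite -sqrf_eq0 sin2cos2 cy2 subrr.
apply/eqP; rewrite -subr_eq0; apply/eqP.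
have -> : x - pi *+ 2 *~ k = y * 2 by rewrite /y mulfVK ?pnatr_eq0.
case: (ltrgt0P y) y_ge0 => [y_gt0 _|//|-> _]; last by rewrite mul0r.
by have := @sin_gt0_pi R y; rewrite y_gt0 y_lt sy ltxx => /(_ isT).
Qed.

Section Centre.
Variables (R : realType) (theta : R).
Local Notation C := R[i].
Local Notation A := (qtorus theta).
Local Notation q := (qphase theta).
Implicit Types (a b : A) (k l : int * int).

Lemma qphaseX n : q ^+ n = qphase (theta *+ n).
Proof.
elim: n => [|n IHn]; first by rewrite /qphase mulr0n cos0 sin0.
rewrite exprS IHn mulrS /qphase; apply/eqP; rewrite eq_complex /=.
by rewrite cosD sinD eqxx [X in _ + X]mulrC addrC mulrC eqxx.
Qed.

Hypothesis theta_irr : irrational (theta / (pi *+ 2)).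

Lemma qphase_eq1 (n : int) : q ^ n = 1 -> n = 0.
Proof.
suff eq1 m : q ^+ m = 1 -> m = 0%N.
  case: n => m; first by move=> /eq1 ->.
  rewrite NegzE -exprz_inv => /(congr1 GRing.inv).
  by rewrite exprz_inv invrK invr1 => /eq1.
have pi2_neq0 : pi *+ 2 != 0 :> R by rewrite lt0r_neq0 // mulrn_wgt0 // pi_gt0.
rewrite qphaseX => /eqP; rewrite eq_complex /= => /andP[/eqP/cos_eq1[k kE] _].
have [//|m0] := eqVneq m 0%N; case: theta_irr; exists (k%:~R / m%:R) => //.
rewrite rmorphM fmorphV /= ratr_int ratr_nat.
apply: (canRL (mulfK pi2_neq0)); rewrite mulrAC mulrzl -kE -[theta *+ m]mulr_natr.
by rewrite mulfK ?pnatr_eq0.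
Qed.

Lemma coef_monoM c k a l :
  (qt_mono theta c k * a)@_(k.1 + l.1, k.2 + l.2) =
  c * a@_l * q ^ (k.2 * l.1).
Proof.
elim/qt_ind: a => [|a b ha hb|d m]; first by rewrite mulr0 !qt_coef0 mulr0 mul0r.
  by rewrite mulrDr !qt_coefD ha hb mulrDr mulrDl.
rewrite qtM_mono !qt_coef_mono !xpair_eqE !(inj_eq (addrI _)) -xpair_eqE.
have [-> | ml] := eqVneq m l; first by rewrite -!surjective_pairing eqxx.
by rewrite -!surjective_pairing (negPf ml) !mulr0n mulr0 mul0r.
Qed.

Lemma coef_Mmono c k a l :
  (a * qt_mono theta c k)@_(k.1 + l.1, k.2 + l.2) =
  a@_l * c * q ^ (l.2 * k.1).
Proof.
elim/qt_ind: a => [|a b ha hb|d m]; first by rewrite mul0r !qt_coef0 !mul0r.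
  by rewrite mulrDl !qt_coefD ha hb !mulrDl.
rewrite qtM_mono !qt_coef_mono !xpair_eqE ![_ + k.1]addrC ![_ + k.2]addrC.
rewrite !(inj_eq (addrI _)) -xpair_eqE -!surjective_pairing.
have [-> | ml] := eqVneq m l; first by rewrite !mulr1n.
by rewrite !mulr0n !mul0r.
Qed.

(** The commutator multiplies the coefficient at [l] by a difference of two
    phases and shifts it to [k + l], which is different from the position [k] of
    the right-hand side. *)
Lemma coef_commutator a (c : C) k l :
  qt_mono theta 1 k * a - a * qt_mono theta 1 k = c *: qt_mono theta 1 k ->
  l != (0, 0) -> a@_l != 0 -> q ^ (k.2 * l.1 - l.2 * k.1) = 1.
Proof.
move=> /(congr1 (fun b : A => b@_(k.1 + l.1, k.2 + l.2))) comm l0 al.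
have qV : q ^ (- (l.2 * k.1)) * q ^ (l.2 * k.1) = 1.
  by rewrite -qphaseD addNr expr0z.
have kl : (k == (k.1 + l.1, k.2 + l.2)) = false.
  apply: contraNF l0; case: k l {al comm qV} => [k1 k2] [l1 l2] /=.
  rewrite !xpair_eqE => /andP[/eqP e1 /eqP e2]; apply/andP.
  by split; apply/eqP; [apply: (addrI k1) | apply: (addrI k2)]; rewrite addr0.
move: comm; rewrite -scaleN1r qt_coefD qt_coefZ mulN1r coef_monoM coef_Mmono.
rewrite qt_coefZ qt_coef_mono kl mulr0 mul1r mulr1 -mulrBr => /eqP.
rewrite mulf_eq0 (negPf al) subr_eq0 => /eqP kl1.
by rewrite addrC qphaseD kl1.
Qed.

(** By irrationality the two phase conditions at [(m, n)] force [m = n = 0].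
    The right-hand sides [c u] and [d v] impose conditions on the constant term
    of [a] alone. *)
Lemma scalar_of_commutators a (c d : C) :
  qt_u theta * a - a * qt_u theta = c *: qt_u theta ->
  qt_v theta * a - a * qt_v theta = d *: qt_v theta ->
  a = (qt_int a)%:A.
Proof.
move=> ua va; apply: qt_eqP => -[m n]; rewrite qt_coefZ qt_coef_mono /qt_int.
have [[<- <-]|mn0] := eqVneq (0, 0) (m, n); first by rewrite mulr1.
rewrite mulr0; apply/eqP; apply: contraNT mn0 => amn.
have [|] := (boolP ((m, n) == (0, 0))); first by rewrite eq_sym.
move=> mn0; have := coef_commutator ua mn0 amn.
have := coef_commutator va mn0 amn => /=.
rewrite mul1r mulr0 subr0 mul0r sub0r mulr1.
by move=> /qphase_eq1 -> /qphase_eq1/eqP; rewrite oppr_eq0 => /eqP->.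
Qed.

Lemma central_scalar a : (forall b, b * a = a * b) -> a = (qt_int a)%:A.
Proof.
by move=> cen; apply: (@scalar_of_commutators a 0 0); rewrite cen subrr scale0r.
Qed.

Section Connection.
Variables (n : nat) (nab : 'rV[A]_n -> 'M[A]_(2, n)).
Variable sig : 'M[A]_(n, 2) -> 'M[A]_(2, n).
Hypothesis conn : bimodule_connection nab sig.

Lemma rscale_delta m p (i : 'I_m) (j : 'I_p) a :
  rscale (delta_mx i j) a = a *: (delta_mx i j : 'M[A]_(m, p)).
Proof.
by apply/matrixP => k l; rewrite !mxE; case: (_ && _);
  rewrite ?mul1r ?mulr1 ?mul0r ?mulr0.
Qed.

Lemma tens_basis p (i : 'I_n) (j : 'I_p) a :
  tens (basis theta i) (a *: basis theta j) = a *: delta_mx i j.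
Proof.
apply/matrixP => k l; rewrite !mxE eqxx /=.
by case: (k == i); case: (l == j); rewrite ?mul1r ?mulr1 ?mul0r ?mulr0.
Qed.

(** A bimodule map sends central elements to central ones, so the coefficients
    of [sigma (e^i (x) s^d)] are scalars.  As [d u] and [d v] are multiples of
    [u s^1] and [v s^2], the two Leibniz rules for [a e^i = e^i a], with [a = u]
    or [a = v], then express the commutators of the coefficients of [nabla e^i]
    with [u] and [v] as scalar multiples of [u] and [v]. *)
Lemma connection_scalar i j (k : 'I_n) :
  nab (basis theta i) j k = (qt_int (nab (basis theta i) j k))%:A.
Proof.
have sig_scalar d : exists s : C, sig (delta_mx i d) j k = s%:A.
  eexists; apply: central_scalar => b; have := connection_sigma conn.
  case=> _ sigl sigr; have := sigr (delta_mx i d) b.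
  by rewrite rscale_delta sigl => /matrixP/(_ j k); rewrite !mxE.
have comm w d : qt_d w = ('i : C)%:A *: (w *: basis theta d) ->
    exists c : C, w * nab (basis theta i) j k - nab (basis theta i) j k * w
      = c *: w.
  move=> dw; have := connectionr conn (basis theta i) w.
  rewrite rscale_delta (connectionl conn) dw scalerA tens_basis.
  have [_ -> _] := connection_sigma conn.
  move=> /matrixP/(_ j k); rewrite !mxE eqxx /= => eq_jk.
  have [s sE] := sig_scalar d.
  exists ('i * (s - ((j == d) && (k == i))%:R)).
  move: eq_jk; rewrite sE => /(canRL (addrK _)) ->.
  have cancel (x y z : A) : x + y - z - x = y - z.
    by rewrite addrAC [x + y]addrC addrK.
  rewrite cancel !mulr_algl mulr_algr scalerA mulrBr scalerBl [s * _]mulrC.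
  congr (_ - _); case: (j == d); case: (k == i);
    by rewrite ?mulr1 ?mulr0 ?mul0r ?scale0r.
have [c uc] : exists c : C, qt_u theta * nab (basis theta i) j k -
    nab (basis theta i) j k * qt_u theta = c *: qt_u theta.
  apply: (comm _ 0); apply/rowP => l; rewrite !mxE qt_partial_mono mulr_algl.
  by case: (l == 0); rewrite ?mulr1 ?mulr0 ?mul0r ?qt_mono0 ?scaler0 ?qtZ_mono
    ?mulr1.
have [d vd] : exists c : C, qt_v theta * nab (basis theta i) j k -
    nab (basis theta i) j k * qt_v theta = c *: qt_v theta.
  apply: (comm _ 1); apply/rowP => l; rewrite !mxE qt_partial_mono mulr_algl.
  by move: l; elim/ord2P => /=; rewrite ?mulr1 ?mulr0 ?mul0r ?qt_mono0 ?scaler0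
    ?qtZ_mono ?mulr1.
exact: scalar_of_commutators uc vd.
Qed.

End Connection.
End Centre.

(** * The Hilbert space structure *)

Section Hilbert.
Variables (R : realType) (theta : R).
Local Notation C := R[i].
Local Notation A := (qtorus theta).
Local Notation conjmx := (map_mx (Num.conj : C -> C)).
Local Notation star := (@qt_star R theta).
Local Notation scal := (scalmx theta).
Implicit Types (a b : A) (phi psi : 'rV[A]_2).

Lemma qt_intD a b : qt_int (a + b) = qt_int a + qt_int b.
Proof. exact: qt_coefD. Qed.

Lemma qt_int_sum (I : Type) (r : seq I) (P : pred I) (f : I -> A) :
  qt_int (\sum_(i <- r | P i) f i) = \sum_(i <- r | P i) qt_int (f i).
Proof. exact: (big_morph _ qt_intD (qt_coef0 _ _)). Qed.

Lemma qt_star_sum (I : Type) (r : seq I) (P : pred I) (f : I -> A) :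
  star (\sum_(i <- r | P i) f i) = \sum_(i <- r | P i) star (f i).
Proof. exact: (big_morph _ (@qt_starD _ _) (qt_star0 _)). Qed.

Lemma qt_partial_sum i (I : Type) (r : seq I) (P : pred I) (f : I -> A) :
  qt_partial i (\sum_(j <- r | P j) f j) =
  \sum_(j <- r | P j) qt_partial i (f j).
Proof. exact: (big_morph _ (qt_partialD i) (qt_partial0 _ _)). Qed.

Lemma qt_star1 : star 1 = 1.
Proof. by rewrite qt_star_mono rmorph1 /= mulr0 expr0z mulr1 oppr0. Qed.

Lemma qt_star_alg (c : C) : star c%:A = (c^*)%:A.
Proof. by rewrite qt_starZ qt_star1. Qed.

Lemma qt_partial_alg i (c : C) : qt_partial i (c%:A : A) = 0.
Proof.
by rewrite qtZ_mono qt_partial_mono; case: (i == 0);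
  rewrite mulr0 mul0r qt_mono0.
Qed.

Lemma qt_partial_star i a : qt_partial i (star a) = star (qt_partial i a).
Proof.
elim/qt_ind: a => [|a b ha hb|c k].
- by rewrite qt_star0 !qt_partial0 qt_star0.
- by rewrite qt_starD !qt_partialD qt_starD ha hb.
rewrite qt_star_mono !qt_partial_mono qt_star_mono /= !rmorphM /= conjCi.
rewrite !rmorph_int !mulrA; congr qt_mono; rewrite !mulNr.
by case: (i == 0); rewrite rmorphN mulrN !mulNr.
Qed.

Lemma qt_int_star a : qt_int (star a) = (qt_int a)^*.
Proof.
elim/qt_ind: a => [|a b ha hb|c k].
- by rewrite qt_star0 /qt_int qt_coef0 rmorph0.
- by rewrite qt_starD !qt_intD ha hb rmorphD.
rewrite qt_star_mono /qt_int !qt_coef_mono; case: k => k1 k2.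
rewrite !xpair_eqE !oppr_eq0; case: eqP => [->|_] /=; last by rewrite rmorph0.
by case: eqP => _ /=; rewrite ?rmorph0 // mul0r expr0z mulr1.
Qed.

Lemma qt_int_partial i a : qt_int (qt_partial i a) = 0.
Proof.
elim/qt_ind: a => [|a b ha hb|c k].
- by rewrite qt_partial0 /qt_int qt_coef0.
- by rewrite qt_partialD qt_intD ha hb addr0.
rewrite qt_partial_mono /qt_int qt_coef_mono; case: k => k1 k2.
rewrite xpair_eqE; case: (k1 =P 0) => [->|_] //=; case: (k2 =P 0) => [->|_] //=.
by rewrite if_same mulr0 mul0r.
Qed.

Lemma qt_int_mulC a b : qt_int (a * b) = qt_int (b * a).
Proof.
elim/qt_ind: a => [|a1 a2 h1 h2|c k]; first by rewrite mul0r mulr0.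
  by rewrite mulrDl mulrDr !qt_intD h1 h2.
elim/qt_ind: b => [|b1 b2 h1 h2|d l]; first by rewrite mul0r mulr0.
  by rewrite mulrDl mulrDr !qt_intD h1 h2.
rewrite !qtM_mono /qt_int !qt_coef_mono [l.1 + _]addrC [l.2 + _]addrC.
rewrite [c * d]mulrC xpair_eqE !addr_eq0.
case: (k.1 =P - l.1) => [->|] //=; case: (k.2 =P - l.2) => [->|] //=.
by rewrite mulNr mulrN.
Qed.

Lemma scalmxM (m n p : nat) (M : 'M[C]_(m, n)) (N : 'M[C]_(n, p)) :
  scal (M *m N) = scal M *m scal N.
Proof. exact: map_mxM. Qed.

Lemma scalmx_sum m n (I : Type) (r : seq I) (P : pred I) (f : I -> 'M[C]_(m, n)) :
  scal (\sum_(i <- r | P i) f i) = \sum_(i <- r | P i) scal (f i).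
Proof. exact: map_mx_sum. Qed.

Lemma scalmx_inj m n : injective (@scalmx R theta m n).
Proof.
move=> M N /matrixP MN; apply/matrixP => i j.
have := MN i j; rewrite !mxE => /(congr1 (@qt_int R theta)).
by rewrite /qt_int !qt_coefZ !qt_coef_mono eqxx !mulr1.
Qed.

Lemma starmx_scal m n (M : 'M[C]_(m, n)) : starmx (scal M) = scal (conjmx M).
Proof. by apply/matrixP => i j; rewrite !mxE qt_star_alg. Qed.

Lemma starmxM_scal m n p (X : 'M[A]_(m, n)) (M : 'M[C]_(n, p)) :
  starmx (X *m scal M) = starmx X *m scal (conjmx M).
Proof.
apply/matrixP => i j; rewrite !mxE qt_star_sum; apply: eq_bigr => k _.
by rewrite !mxE !mulr_algr qt_starZ.
Qed.

Lemma starmxK m n : involutive (@starmx R theta m n).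
Proof. by move=> X; apply/matrixP => i j; rewrite !mxE qt_starK. Qed.

Definition partialmx m n (i : 'I_2) (X : 'M[A]_(m, n)) : 'M[A]_(m, n) :=
  map_mx (qt_partial i) X.

Lemma partialmxM_scal i m n p (X : 'M[A]_(m, n)) (M : 'M[C]_(n, p)) :
  partialmx i (X *m scal M) = partialmx i X *m scal M.
Proof.
apply/matrixP => j k; rewrite !mxE qt_partial_sum; apply: eq_bigr => l _.
by rewrite !mxE qt_partialM qt_partial_alg mulr0 addr0.
Qed.

Lemma partialmx_star i m n (X : 'M[A]_(m, n)) :
  partialmx i (starmx X) = starmx (partialmx i X).
Proof. by apply/matrixP => j k; rewrite !mxE qt_partial_star. Qed.

Lemma ipDr phi psi psi' : ip phi (psi + psi') = ip phi psi + ip phi psi'.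
Proof.
rewrite /ip -qt_intD -big_split /=; congr qt_int.
by apply: eq_bigr => i _; rewrite !mxE mulrDr.
Qed.

Lemma ip_conj phi psi : (ip phi psi)^* = ip psi phi.
Proof.
rewrite /ip -qt_int_star qt_star_sum; congr qt_int.
by apply: eq_bigr => i _; rewrite qt_starM qt_starK.
Qed.

Lemma ip0r phi : ip phi 0 = 0.
Proof. by rewrite /ip big1 /qt_int ?qt_coef0 // => i _; rewrite mxE mulr0. Qed.

Lemma ip_sumr (I : Type) (r : seq I) (P : pred I) phi (f : I -> 'rV[A]_2) :
  ip phi (\sum_(i <- r | P i) f i) = \sum_(i <- r | P i) ip phi (f i).
Proof. exact: (big_morph _ (ipDr phi) (ip0r phi)). Qed.

Lemma ip_suml (I : Type) (r : seq I) (P : pred I) psi (f : I -> 'rV[A]_2) :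
  ip (\sum_(i <- r | P i) f i) psi = \sum_(i <- r | P i) ip (f i) psi.
Proof.
rewrite -ip_conj ip_sumr rmorph_sum /=.
by apply: eq_bigr => i _; rewrite ip_conj.
Qed.

Lemma ipZr (c : C) phi psi : ip phi (c%:A *: psi) = c * ip phi psi.
Proof.
rewrite /ip !qt_int_sum mulr_sumr; apply: eq_bigr => i _.
by rewrite mxE mulr_algl -scalerAr /qt_int qt_coefZ.
Qed.

Lemma ipZl (c : C) phi psi : ip (c%:A *: phi) psi = c^* * ip phi psi.
Proof. by rewrite -ip_conj ipZr rmorphM /= ip_conj. Qed.

Lemma ip_adjoint phi psi (M : 'M[C]_2) :
  ip phi (psi *m scal M) = ip (phi *m scal (conjmx M^T)) psi.
Proof.
rewrite /ip !qt_int_sum.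
under eq_bigr do rewrite mxE mulr_sumr qt_int_sum.
rewrite exchange_big /=; apply: eq_bigr => i _.
rewrite mxE qt_star_sum mulr_suml qt_int_sum; apply: eq_bigr => j _.
by rewrite !mxE !mulr_algr qt_starZ conjCK -scalerAl -scalerAr.
Qed.

(** The integral of a total derivative vanishes. *)
Lemma ip_partial i phi psi :
  ip phi (partialmx i psi) = - ip (partialmx i phi) psi.
Proof.
rewrite /ip !qt_int_sum -sumrN; apply: eq_bigr => j _; rewrite !mxE.
apply/eqP; rewrite -addr_eq0 -qt_intD addrC -qt_partial_star -qt_partialM.
by rewrite qt_int_partial.
Qed.

(** The trace property of the integral. *)
Lemma ip_star phi psi : ip (starmx phi) (starmx psi) = (ip phi psi)^*.
Proof.
rewrite ip_conj /ip !qt_int_sum; apply: eq_bigr => i _.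
by rewrite !mxE qt_starK qt_int_mulC.
Qed.

End Hilbert.

(** * Weak quantum Levi-Civita connections *)

Section Geometry.
Variables (R : realType) (theta : R).
Local Notation C := R[i].
Local Notation A := (qtorus theta).
Local Notation conjmx := (map_mx (Num.conj : C -> C)).
Local Notation scal := (scalmx theta).
Local Notation e i := (basis theta i).
Implicit Types (phi psi : 'rV[A]_2).

Lemma d1_basis i : qt_d1 (e i) = 0.
Proof.
rewrite /qt_d1 big1 /wedge ?mxE ?subrr // => j _.
apply/matrixP => k l; rewrite !mxE.
suff -> : qt_partial k ((0 == 0 :> 'I_1) && (j == i))%:R = 0 :> A by rewrite mul0r.
by case: (_ && _); rewrite ?qt_partial0 // -(qt_partial_alg theta k 1) scale1r.
Qed.

Lemma metric_col k : (col k (metric theta))^T = e k.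
Proof.
apply/rowP => l; rewrite !mxE summxE (bigD1 k) //= !mxE big1; last first.
  by move=> j /negPf jk; rewrite !mxE eqxx /= [k == j]eq_sym jk mulr0.
by rewrite !eqxx addr0 mulr1.
Qed.

(** Torsion freeness is symmetry in the last two indices and cotorsion freeness
    is symmetry in the first two. *)
Lemma WQLC_symm nab : WQLC nab ->
  forall i j k, nab (e i) j k = nab (e k) j i.
Proof.
case=> sig [_ _ tors cotors].
have s12 i j k : nab (e i) j k = nab (e i) k j.
  have := tors (e i); rewrite d1_basis /wedge => /eqP; rewrite subr_eq0 => /eqP.
  by move: j k; elim/ord2P; elim/ord2P.
have s01 i j k : nab (e i) j k = nab (e j) i k.
  move: cotors => /rowP/(_ k); rewrite /cotorsion summxE.
  rewrite !big_ord_recl big_ord0 !metric_col !d1_basis !scale0r !sub0r.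
  rewrite !mxE /= addr0 /wedge !mxE /= !mul1r !mul0r subr0 sub0r.
  rewrite (_ : lift 0 0 = 1 :> 'I_2); last exact: val_inj.
  rewrite opprK => /eqP; rewrite addrC subr_eq0 => /eqP.
  by move: i j; elim/ord2P; elim/ord2P.
by move=> i j k; rewrite s01 s12 s01.
Qed.

Lemma connection_sum n (nab : 'rV[A]_n -> 'M[A]_(2, n)) sig :
  bimodule_connection nab sig -> forall w j k,
  nab w j k = qt_partial j (w 0 k) + \sum_a w 0 a * nab (e a) j k.
Proof.
case=> _ nabD nabl _ w j k.
have nab0 : nab 0 = 0 by apply: (addrI (nab 0)); rewrite -nabD !addr0.
rewrite {1}[w]row_sum_delta (big_morph _ nabD nab0) summxE.
under eq_bigr do rewrite nabl !mxE.
rewrite big_split addrC; congr (_ + _).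
rewrite (bigD1 k) //= big1 ?eqxx ?mulr1 ?addr0 // => a /negPf ak.
by rewrite eq_sym ak mulr0.
Qed.

Lemma connection_flat n (nab : 'rV[A]_n -> 'M[A]_(2, n)) sig :
  bimodule_connection nab sig -> (forall a, nab (e a) = 0) ->
  forall w j, row j (nab w) = partialmx j w.
Proof.
move=> conn flat w j; apply/rowP => k.
rewrite !mxE (connection_sum conn) big1 ?addr0 // => a _.
by rewrite flat mxE mulr0.
Qed.

Definition flat_connection (w : 'rV[A]_2) : 'M[A]_2 :=
  \matrix_(j, k) qt_partial j (w 0 k).

Lemma flat_basis i : flat_connection (e i) = 0.
Proof.
apply/matrixP => j k; rewrite !mxE; case: (_ && _); rewrite ?qt_partial0 //.
by rewrite -(qt_partial_alg theta j 1) scale1r.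
Qed.

Lemma flat_bimodule_connection : bimodule_connection flat_connection trmx.
Proof.
split.
- split=> [x y|a x|x a]; apply/matrixP => i j; by rewrite !mxE.
- by move=> x y; apply/matrixP => i j; rewrite !mxE qt_partialD.
- by move=> a x; apply/matrixP => i j; rewrite !mxE qt_partialM addrC.
by move=> x a; apply/matrixP => i j; rewrite !mxE qt_partialM.
Qed.

(** The generalised braiding is the flip, that is the transposition of
    coordinates. *)
Lemma flat_WQLC : WQLC flat_connection.
Proof.
exists trmx; split; first exact: flat_bimodule_connection.
- by move=> w; apply/matrixP => i j; rewrite !mxE qt_partial_star.
- move=> w; rewrite /qt_d1 /wedge !summxE !big_ord_recl !big_ord0 !mxE /=.
  by rewrite (_ : lift 0 0 = 1 :> 'I_2) ?mulr0 ?mulr1 ?addr0 ?add0r //;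
    apply: val_inj.
apply/rowP => k; rewrite summxE big1 ?mxE // => i _.
rewrite flat_basis metric_col d1_basis !mxE /wedge !mxE.
by rewrite mul0r !mulr0 !subrr.
Qed.

(** * Dirac operators *)

Implicit Types (T : spinor_data theta).

Lemma dirac_flat T sig : bimodule_connection (nablaS T) sig ->
  (forall a, nablaS T (e a) = 0) ->
  forall psi, dirac_op T psi = \sum_i partialmx i psi *m scal (Cliff T i).
Proof.
move=> conn flat psi; apply: eq_bigr => i _.
by rewrite (connection_flat conn flat).
Qed.

Lemma pauli_diracE psi :
  pauli_dirac psi = \sum_i partialmx i psi *m scal (pauli R i).
Proof.
apply/rowP => b; rewrite !mxE summxE; apply: eq_bigr => i _.
by rewrite mxE; apply: eq_bigr => a _; rewrite [scal _ a b]mxE mulr_algr !mxE.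
Qed.

Lemma flat_antihermitian (c : 'I_2 -> 'M[C]_2) :
  (forall i, conjmx (c i)^T = c i) ->
  antihermitian_op (fun psi => \sum_i partialmx i psi *m scal (c i)).
Proof.
move=> c_herm phi psi; rewrite ip_sumr ip_suml -sumrN.
apply: eq_bigr => i _; rewrite ip_adjoint c_herm ip_partial.
by rewrite partialmxM_scal.
Qed.

(** The coefficient matrix of the Dirac operator on the plane wave
    [u^m v^n], [k = (m, n)]. *)
Definition symbol (c S : 'I_2 -> 'M[C]_2) (k : int * int) : 'M[C]_2 :=
  \sum_i (('i * (if i == 0 then k.1 else k.2)%:~R)%:M + S i) *m c i.

Local Notation wave k := (qt_mono theta 1 k).

Lemma ip_wave k a b (M N : 'M[C]_2) :
  ip (wave k *: row a (scal M)) (wave k *: row b (scal N)) =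
  (N *m conjmx M^T) b a.
Proof.
rewrite /ip qt_int_sum mxE; apply: eq_bigr => c _.
rewrite !mxE qt_starM qt_star_alg !mulr_algl !mulr_algr -scalerAl -scalerAr.
rewrite qt_star_mono qtM_mono rmorph1 mul1r mulr1 -qphaseD /qt_int !qt_coefZ.
rewrite qt_coef_mono !addNr mulNr [k.2 * _]mulrC subrr expr0z eqxx mulr1.
by rewrite mulrC.
Qed.

(** Plane waves are joint eigenvectors of the partial derivatives. *)
Lemma dirac_wave T sig (S : 'I_2 -> 'M[C]_2) k a :
  bimodule_connection (nablaS T) sig ->
  (forall i, Scoef (nablaS T) i = scal (S i)) ->
  dirac_op T (wave k *: e a) =
  wave k *: row a (scal (symbol (Cliff T) S k)).
Proof.
move=> conn SE.
have nabE i : row i (nablaS T (wave k *: e a)) = wave k *: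
    row a (scal (('i * (if i == 0 then k.1 else k.2)%:~R)%:M + S i)).
  apply/rowP => b; rewrite !mxE (connection_sum conn) !mxE eqxx /=.
  rewrite (bigD1 a) //= big1; last first.
    by move=> d /negPf da; rewrite !mxE da mulr0 mul0r.
  rewrite [(wave k *: e a) _ _]mxE [e a _ _]mxE !eqxx mulr1 addr0.
  have /matrixP/(_ a b) := SE i; rewrite !mxE => ->.
  rewrite scalerDl mulrDr [a == b]eq_sym !mulr_algr; congr (_ + _).
  case: (b == a); last by rewrite mulr0 qt_partial0 scale0r.
  by rewrite mulr1 mulr1n qt_partial_mono qtZ_mono mulr1.
rewrite /symbol scalmx_sum raddf_sum /= scaler_sumr; apply: eq_bigr => i _.
by rewrite nabE scalmxM row_mul scalemxAl.
Qed.

(** Antihermiticity of the Dirac operator on plane waves says that its symbol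
    is antihermitian; comparing the waves [1], [u] and [v] separates the
    coefficients of the derivatives from the remaining term. *)
Lemma antihermitian_symbol T sig (S : 'I_2 -> 'M[C]_2) :
  bimodule_connection (nablaS T) sig ->
  (forall i, Scoef (nablaS T) i = scal (S i)) ->
  antihermitian_op (dirac_op T) ->
  (forall i, conjmx (Cliff T i)^T = Cliff T i) /\
  conjmx (\sum_i S i *m Cliff T i)^T = - \sum_i S i *m Cliff T i.
Proof.
move=> conn SE anti; pose B := \sum_i S i *m Cliff T i.
have waveE k a : wave k *: e a = wave k *: row a (scal 1%:M).
  congr (_ *: _); apply/rowP => b; rewrite !mxE eqxx /= [b == a]eq_sym.
  by case: (a == b); rewrite ?scale1r ?scale0r.
have symb k : conjmx (symbol (Cliff T) S k)^T = - symbol (Cliff T) S k.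
  apply/matrixP => b a; rewrite [RHS]mxE.
  have := anti (wave k *: e a) (wave k *: e b).
  rewrite !(dirac_wave _ _ conn SE) !waveE !ip_wave trmx1 map_mx1 mulmx1 mul1mx.
  by move=> ->; rewrite opprK.
have B_anti : conjmx B^T = - B.
  have := symb (0, 0); rewrite /symbol.
  by under eq_bigr do rewrite if_same mulr0 raddf0 add0r.
split=> // i.
pose k : int * int := if i == 0 then (1, 0) else (0, 1).
have symbE : symbol (Cliff T) S k = 'i *: Cliff T i + B.
  rewrite /symbol; under eq_bigr do rewrite mulmxDl mul_scalar_mx.
  rewrite big_split /=; congr (_ + _); rewrite (bigD1 i) //= big1 => [|j].
    by rewrite addr0 /k; case: (i == 0); rewrite mulr1.
  rewrite /k; move: i j {k}; elim/ord2P; elim/ord2P => //= _;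
    by rewrite mulr0 scale0r.
have := symb k; rewrite symbE linearD /= map_mxD B_anti opprD => /addIr.
rewrite linearZ /= map_mxZ /= conjCi scaleNr => /oppr_inj.
by move/(scalerI (neq0Ci _)).
Qed.

(** * Geometrically realised spectral triples *)

Lemma sign_unit (eps : C) : is_sign eps -> eps != 0.
Proof. by case=> ->; rewrite ?oppr_eq0 oner_eq0. Qed.

(** The scalar coefficients turn the local conditions into identities between
    complex matrices, where the two vanishing results for Clifford pairs
    apply. *)
Lemma geom_realised_flat (eps eps' eps'' : C) T :
  irrational (theta / (pi *+ 2)) -> geom_realised eps eps' eps'' T ->
  [/\ clifford_rel (Cliff T), forall i, conjmx (Cliff T i)^T = Cliff T i,
      forall i, nabla T (e i) = 0 & forall a, nablaS T (e a) = 0].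
Proof.
move=> irr [[sgn _ _] [wqlc [sigS connS]]].
case=> -[JJ SJ CJ cov c_rel] _ [anti _ _].
have [sig [conn _ _ _]] := wqlc.
pose x i j k := qt_int (nabla T (e i) j k).
have xE i j k : nabla T (e i) j k = (x i j k)%:A.
  by rewrite [LHS](connection_scalar irr conn).
pose S i : 'M[C]_2 := \matrix_(a, b) qt_int (nablaS T (e a) i b).
have SE i : Scoef (nablaS T) i = scal (S i).
  by apply/matrixP => a b; rewrite !mxE [LHS](connection_scalar irr connS).
have [c_herm B_anti] := antihermitian_symbol connS SE anti.
have covx i j : Cliff T i *m S j - S j *m Cliff T i =
    \sum_k x i j k *: Cliff T k.
  apply: (@scalmx_inj R theta); rewrite scalmx_sum /scalmx map_mxB !map_mxM /=.
  have := cov i j; rewrite SE => ->; apply: eq_bigr => k _.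
  rewrite /Gamma xE !scalerA mulrNN mulVf ?pnatr_eq0 // mul1r.
  by apply/matrixP => a b; rewrite !mxE mulr_algl scalerA.
have x0 := covariant_symm_eq0 c_rel covx.
have {}x0 i j k : x i j k = 0.
  by apply: x0 => i1 j1 k1; rewrite /x (WQLC_symm wqlc).
have comm i j : Cliff T i *m S j = S j *m Cliff T i.
  apply/eqP; rewrite -subr_eq0 covx big1 // => k _.
  by rewrite x0 scale0r.
have J_unit : Jmat T \in unitmx.
  have eps_unit : eps%:M \in @unitmx C 2.
    by rewrite unitmxE det_scalar unitfE expf_neq0 // sign_unit.
  by move: eps_unit; rewrite -JJ unitmx_mul => /andP[].
have realS i : conjmx (S i) *m Jmat T = Jmat T *m S i.
  apply: (@scalmx_inj R theta).
  by rewrite !scalmxM -starmx_scal -SE; apply: SJ.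
have S0 := invariant_real_eq0 c_rel c_herm comm J_unit realS B_anti.
split=> // [i|a]; apply/matrixP => j k; first by rewrite xE x0 mxE scale0r.
by have /matrixP/(_ a k) := SE j; rewrite S0 /scalmx map_mx0 !mxE => ->.
Qed.

Lemma geom_realised_dirac (eps eps' eps'' : C) T :
  irrational (theta / (pi *+ 2)) -> geom_realised eps eps' eps'' T ->
  forall psi, dirac_op T psi = \sum_i partialmx i psi *m scal (Cliff T i).
Proof.
move=> irr real; have [_ _ _ flatS] := geom_realised_flat irr real.
have [_ [_ [sigS connS] _ _]] := real.
exact: dirac_flat connS flatS.
Qed.

Lemma dirac_change_basis (eps eps' eps'' : C) T (u : 'M[C]_2) :
  irrational (theta / (pi *+ 2)) -> geom_realised eps eps' eps'' T ->
  u \in unitmx -> (forall i, u *m Cliff T i *m invmx u = pauli R i) ->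
  forall psi, dirac_op (change_basis u T) psi = pauli_dirac psi.
Proof.
move=> irr real u_unit uE psi.
have [_ _ _ flatS] := geom_realised_flat irr real.
have [_ [_ [sigS connS] _ _]] := real.
rewrite pauli_diracE; apply: eq_bigr => i _ /=.
rewrite uE row_mul (connection_flat connS flatS) partialmxM_scal.
by rewrite -[_ *m scal u *m _]mulmxA -scalmxM mulmxV // /scalmx map_mx1 mulmx1.
Qed.

Lemma mulmx_scalZ (eps : C) (M : 'M[C]_2) psi :
  psi *m scal (eps *: M) = eps%:A *: (psi *m scal M).
Proof.
apply/rowP => j; rewrite !mxE mulr_sumr; apply: eq_bigr => k _.
by rewrite !mxE mulr_algl !mulr_algr scalerA.
Qed.

Lemma charge_conjZ (J : 'M[C]_2) (c : C) psi :
  charge_conj J (c%:A *: psi) = (c^*)%:A *: charge_conj J psi.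
Proof.
rewrite /charge_conj scalemxAl; congr (_ *m _); apply/matrixP => i j.
by rewrite !mxE !mulr_algl qt_starZ.
Qed.

Lemma charge_conjM (J M N : 'M[C]_2) psi :
  conjmx M *m J = J *m N ->
  charge_conj J (psi *m scal M) = charge_conj J psi *m scal N.
Proof.
by move=> MJ; rewrite /charge_conj starmxM_scal -!mulmxA -!scalmxM MJ.
Qed.

Lemma charge_conj_sum (J : 'M[C]_2) (f : 'I_2 -> 'rV[A]_2) :
  charge_conj J (\sum_i f i) = \sum_i charge_conj J (f i).
Proof.
rewrite /charge_conj -mulmx_suml; congr (_ *m _); apply/rowP => j.
by rewrite !(mxE, summxE) qt_star_sum; apply: eq_bigr => i _; rewrite !mxE.
Qed.

Lemma charge_conj_partial (J : 'M[C]_2) i psi :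
  charge_conj J (partialmx i psi) = partialmx i (charge_conj J psi).
Proof. by rewrite /charge_conj partialmxM_scal partialmx_star. Qed.

Lemma charge_conjK (J : 'M[C]_2) (eps : C) psi :
  conjmx J *m J = eps%:M ->
  charge_conj J (charge_conj J psi) = eps%:A *: psi.
Proof.
move=> JJ; rewrite /charge_conj starmxM_scal starmxK -mulmxA -scalmxM JJ.
by rewrite -scalemx1 mulmx_scalZ /scalmx map_mx1 mulmx1.
Qed.

(** The sign of [epsilon'] changes because the factor [i] in the hermitian
    Dirac operator anticommutes with the antilinear charge conjugation. *)
Lemma geom_realised_signs (eps eps' eps'' : C) T :
  irrational (theta / (pi *+ 2)) -> geom_realised eps eps' eps'' T ->
  [/\ hermitian_op (dirac_herm T), real_signs eps (- eps') T &
      isSome (gam T) -> even_sign eps'' T].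
Proof.
move=> irr real; have dE := geom_realised_dirac irr real.
have [_ [_ _ [[JJ _ CJ _ _] gamT] [anti _ _]]] := real.
split.
- move=> phi psi; rewrite /dirac_herm ipZr ipZl anti conjCi.
  by rewrite mulNr mulrN.
- split=> psi; first exact: charge_conjK.
  rewrite /dirac_herm charge_conjZ conjCi scalerA !dE.
  have algM (c d : C) : c%:A * d%:A = (c * d)%:A :> A.
    by rewrite mulr_algl scalerA.
  rewrite algM charge_conj_sum !scaler_sumr; apply: eq_bigr => i _.
  rewrite (@charge_conjM _ _ (eps' *: Cliff T i)) ?CJ ?scalemxAr //.
  by rewrite charge_conj_partial mulmx_scalZ scalerA algM mulNr mulrC -mulNr.
case gE: (gam T) gamT => [g|] // [_ _ gJ _] _; exists g => // psi.
rewrite /grading -mulmx_scalZ; apply: charge_conjM.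
by rewrite gJ scalemxAr.
Qed.

Definition pauli_triple (J : 'M[C]_2) (g : option 'M[C]_2) : spinor_data theta :=
  SpinorData flat_connection flat_connection (pauli R) J g.

Lemma pauli_triple_dirac J g psi :
  dirac_op (pauli_triple J g) psi = pauli_dirac psi.
Proof.
rewrite pauli_diracE; apply: dirac_flat psi; first exact: flat_bimodule_connection.
exact: flat_basis.
Qed.

(** On the flat connections the conditions on [nabla] and [S] hold trivially,
    and partial integration makes the Dirac operator antihermitian.  What
    remains are conditions on [J] and [g]; unitarity of [J] gives the isometry
    by the trace property of the integral. *)
Lemma pauli_triple_realised (eps eps' eps'' : C) J g :
  is_sign eps -> is_sign eps' -> is_sign eps'' ->
  conjmx J *m J = eps%:M ->
  (forall i, conjmx (pauli R i) *m J = eps' *: (J *m pauli R i)) ->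
  J *m conjmx J^T = 1%:M ->
  (if g is Some g then
     [/\ g *m g = 1%:M, forall i, pauli R i *m g + g *m pauli R i = 0,
         conjmx g *m J = eps'' *: (J *m g) & conjmx g^T = g] else True) ->
  geom_realised eps eps' eps'' (pauli_triple J g).
Proof.
move=> s1 s2 s3 JJ CJ Junit gP; split=> //.
have S0 i : Scoef (theta := theta) flat_connection i = 0.
  by apply/matrixP => a b; rewrite mxE flat_basis !mxE.
split=> /=; first exact: flat_WQLC.
- by exists trmx; exact: flat_bimodule_connection.
- split; [split=> //= [i|i j|] | ].
  + rewrite S0 mulmx0; apply/matrixP => a b; rewrite mxE big1 ?mxE // => k _.
    by rewrite !mxE qt_star0 mul0r.
  + rewrite S0 mulmx0 mul0mx subrr big1 // => k _.
    by rewrite /Gamma flat_basis mxE scaler0 scaler0 scale0r.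
  + exact: pauli_clifford.
  case: g gP => //= g [gg Cg gJ _]; split=> // i.
  by rewrite S0 mul0mx mulmx0.
split.
- move=> phi psi; rewrite !pauli_triple_dirac !pauli_diracE.
  exact: flat_antihermitian (pauli_herm R) phi psi.
- split=> [phi psi|c psi|phi psi]; last 1 first.
  + rewrite /charge_conj ip_adjoint -mulmxA -scalmxM Junit.
    by rewrite /scalmx map_mx1 mulmx1 ip_star.
  + rewrite /charge_conj -mulmxDl; congr (_ *m _).
    by apply/rowP => i; rewrite !mxE qt_starD.
  + exact: charge_conjZ.
case: g gP => //= g [_ _ _ gherm] phi psi.
by rewrite /grading ip_adjoint gherm.
Qed.

End Geometry.

(** * The two charge conjugations *)

Section ChargeConjugations.
Variable R : realType.
Local Notation C := R[i].
Local Notation conjmx := (map_mx (Num.conj : C -> C)).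

(** The real matrix [i sigma^2] has square [-1] and anticommutes with [sigma^1]
    and the chirality [sigma^3], which are real, but commutes with [sigma^2],
    whose conjugate is its opposite; hence all signs are [-1]. *)
Definition quaternionic_J : 'M[C]_2 := 'i *: pauli R 1.

Lemma conj_quaternionic_J : conjmx quaternionic_J = quaternionic_J.
Proof. by rewrite map_mxZ /= conjCi conj_pauli1 scaleNr scalerN opprK. Qed.

Lemma quaternionic_J_sqr : quaternionic_J *m quaternionic_J = (-1)%:M.
Proof.
rewrite -scalemxAl -scalemxAr scalerA -expr2 sqrCi clifford_sqr.
  by rewrite scalemx1.
exact: pauli_clifford.
Qed.

Variable theta : R.

Lemma KO2_triple_realised :
  geom_realised (-1) (-1) (-1)
    (pauli_triple theta quaternionic_J (Some (chirality (pauli R)))).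
Proof.
have c_rel := pauli_clifford R; have c_herm := pauli_herm R.
apply: pauli_triple_realised; rewrite ?conj_quaternionic_J; try by right.
- exact: quaternionic_J_sqr.
- elim/ord2P; rewrite scaleN1r /quaternionic_J.
    rewrite conj_pauli0 -scalemxAl -scalemxAr clifford_anti // scalerN.
    by rewrite opprK.
  by rewrite conj_pauli1 mulNmx -scalemxAl -scalemxAr.
- rewrite linearZ /= map_mxZ /= c_herm conjCi scaleNr mulmxN.
  by rewrite quaternionic_J_sqr -raddfN opprK.
split.
- exact: chirality_sqr.
- by move=> i; rewrite chirality_anti // addNr.
- have -> : conjmx (chirality (pauli R)) = chirality (pauli R).
    rewrite map_mxZ map_mxM rmorphN /= conjCi conj_pauli0 conj_pauli1 mulmxN.
    by rewrite scalerN scaleNr opprK.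
  move: (chirality_anti c_rel 1); move: (chirality _) => g anti.
  by rewrite scaleN1r /quaternionic_J -scalemxAl -scalemxAr anti scalerN opprK.
exact: chirality_herm.
Qed.

(** The charge conjugation [sigma^1] is real with square one, and its
    anticommutation with [sigma^2] compensates for the conjugation. *)
Lemma KO1_triple_realised (eps'' : C) : is_sign eps'' ->
  geom_realised 1 1 eps'' (pauli_triple theta (pauli R 0) None).
Proof.
have c_rel := pauli_clifford R.
move=> s; apply: pauli_triple_realised => //; try by left.
- by rewrite conj_pauli0 clifford_sqr.
- elim/ord2P; first by rewrite conj_pauli0 scale1r.
  by rewrite conj_pauli1 scale1r mulNmx clifford_anti // opprK.
by rewrite pauli_herm clifford_sqr.
Qed.

End ChargeConjugations.

Theorem theorem3p4 (R : realType) (theta : R)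
    (theta_irr : irrational (theta / (pi *+ 2))) :
  [/\ (forall (eps eps' eps'' : R[i]) (T : spinor_data theta),
         geom_realised eps eps' eps'' T ->
         [/\ exists u : 'M[R[i]]_2, u \is unitarymx /\
               forall psi, dirac_op (change_basis u T) psi = pauli_dirac psi,
             forall i, nabla T (basis theta i) = 0 &
             forall a, nablaS T (basis theta a) = 0]),
      (exists T : spinor_data theta,
         [/\ isSome (gam T), geom_realised (-1) (-1) (-1) T &
             forall psi, dirac_op T psi = pauli_dirac psi]) /\
      (forall T : spinor_data theta,
         isSome (gam T) -> geom_realised (-1) (-1) (-1) T ->
         (forall psi, dirac_op T psi = pauli_dirac psi) ->
         hermitian_op (dirac_herm T) /\ KO_dim2 T) &
      forall eps'' : R[i], is_sign eps'' ->
      (exists T : spinor_data theta,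
         [/\ gam T = None, geom_realised 1 1 eps'' T &
             forall psi, dirac_op T psi = pauli_dirac psi]) /\
      (forall T : spinor_data theta,
         geom_realised 1 1 eps'' T ->
         (forall psi, dirac_op T psi = pauli_dirac psi) ->
         hermitian_op (dirac_herm T) /\ KO_dim1 T)].
Proof.
split.
- move=> eps eps' eps'' T real.
  have [c_rel c_herm flat flatS] := geom_realised_flat theta_irr real.
  split=> //; have [u u_unitary uE] := clifford_pauli_frame c_rel c_herm.
  exists u; split=> //.
  exact: (dirac_change_basis theta_irr real (unitarymx_unit u_unitary) uE).
- split.
    exists (pauli_triple theta (quaternionic_J R) (Some (chirality (pauli R)))).
    by split=> //; [exact: KO2_triple_realised | exact: pauli_triple_dirac].
  move=> T gT real _.
  have [herm signs even] := geom_realised_signs theta_irr real.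
  by split=> //; split; [rewrite opprK in signs | exact: even].
move=> eps'' sgn; split.
  exists (pauli_triple theta (pauli R 0) None).
  by split=> //; [exact: KO1_triple_realised | exact: pauli_triple_dirac].
by move=> T real _; have [] := geom_realised_signs theta_irr real.
Qed.
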